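(* For every $\varepsilon>0$ there exists $k_0=k_0(\varepsilon)$ such that for every $k>k_0$ and every $2\le r\le k$ there is a constant $c=c(\varepsilon,k)>0$ such that every $k$-uniform hypergraph with $m$ edges has an $r$-cut of surplus at least $c\,m^{2/3-\varepsilon}$.
   Context: For a $k$-uniform hypergraph $H$, an $r$-cut is a partition of $V(H)$ into $r$ parts; its size is the number of edges having at least one vertex in each part. The surplus of an $r$-cut in a $k$-uniform hypergraph with $m$ edges is its size minus $\frac{S(k,r)\,r!}{r^k}m$, where $S(k,r)$ is the Stirling number of the second kind (this is the expected size of a uniformly random $r$-cut). *)

(* Defs.v *)
From mathcomp Require Import all_boot all_order all_algebra.
From mathcomp Require Import reals exp.

Set Implicit Arguments.
Unset Strict Implicit.
Unset Printing Implicit Defensive.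

Import Order.TTheory GRing.Theory Num.Theory.

Local Open Scope ring_scope.

Definition stirling2 (k r : nat) : nat :=
  #|[set P : {set {set 'I_k}} | partition P [set: 'I_k] & #|P| == r]|.

(* A hypergraph on the vertex set T is given by its set E of edges, so that it
   has no repeated edges. *)
Definition uniform_hypergraph (k : nat) (T : finType) (E : {set {set T}}) : Prop :=
  forall e : {set T}, e \in E -> #|e| = k.

(* The parts of a MathComp partition are nonempty. *)
Definition is_cut (r : nat) (T : finType) (P : {set {set T}}) : Prop :=
  partition P [set: T] /\ #|P| = r.

Definition cut_size (T : finType) (E P : {set {set T}}) : nat :=
  #|[set e in E | [forall B in P, e :&: B != set0]]|.

Definition surplus (R : realType) (k r : nat) (T : finType)
    (E P : {set {set T}}) : R :=
  (cut_size E P)%:R - (stirling2 k r * r`!)%:R / r%:R ^+ k * #|E|%:R.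

(* Main.v *)
(** Write [m = B^(3L)] and [A = B^L] with [L >= 1/eps], and colour the vertices
    uniformly at random.  If the codegrees [d(u,v)] have a large square sum, a
    density [1 + t h] with [h] a quadratic form in mean-zero variables already
    gains about [(sum d(u,v)^2)^(1/2) >= A^2].  Otherwise a positive proportion
    of the edges has all its codegrees at most [A] and all its degrees, but at
    most one, of order at most [A^2].  Along subsets of such an edge [e] of sizes
    [j0^i + 1], the largest degree decreases from at most [A = B^L] to at least
    [1] while [i] runs from [0] to [L], so at some level it loses at most a factor
    [B]; this is where [k] has to be large.  Hence there are sets [S], of a fixed
    odd size [s], and vertices [u = apex S] with [d(S + u) >= d(S) / B], where only
    one [u] is kept for each [S].  Put [z_u = A^-1 * sum of X_S over apex S = u],
    where [X_S] is a product of mean-zero variables, and tilt the colour of [u] in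
    proportion to [t z_u].  The linear term of the expected cut is of order
    [t A^-1 m / B = t A^2 / B].  The terms of degree [j >= 2] are estimated by
    counting tuples [S_1, ..., S_j] of sets with distinct apexes in which no vertex
    outside [e] is covered exactly once; a set determines its apex, so no two of
    the [S_i] agree, and the tuples are too few to cancel the gain when
    [t = tau / B^2].  Hypercontractivity allows to truncate [z_u]. *)

Require Import Defs.
From mathcomp Require Import all_boot all_order all_algebra.
From mathcomp Require Import reals exp.
From mathcomp Require Import ring lra zify.

Set Implicit Arguments.
Unset Strict Implicit.
Unset Printing Implicit Defensive.

Import Order.TTheory GRing.Theory Num.Theory.

Local Open Scope ring_scope.

(** * Averages over random colourings *)

(** No cut is exhibited. [D] is any upper bound on the surplus of all colourings, and averaging
    against a density bounds [D] from below; a maximal colouring then has that surplus. The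
    correlation of the cut indicator of an edge with a product of [s + 1] mean-zero variables must
    be one nonzero number for all edges and all sets, whatever [r] is. The variables live on pairs
    of colours, and random roles [0..s] of the vertices make every set use each pair of colours a
    fixed even number of times. Only squares then occur in the correlation and no signs cancel; this
    is why [s] is odd. The roles also keep every apex out of every [S], so that no [z_u] depends on
    the colour of an apex and the product density has mean one. The exponent of [B] in [t] balances
    the linear gain [t m / (A B)] against the quadratic terms, which may reach [t^2 m B / A]. Beyond
    degree [j0] counting saves nothing, but there [t^j0 <= tau / (A B)] as [2 j0 > L]. In all a
    factor [B^3] is lost, and [A^2 / B^3 = m^(2/3 - 1/L)]. *)

Section Average.
Variables (R : realFieldType) (T : finType) (C : finType).
Hypothesis C_gt0 : (0 < #|C|)%N.
Implicit Types (f : {ffun T -> C}) (G H : {ffun T -> C} -> R).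

Definition avg G : R := (#|{ffun T -> C}|%:R)^-1 * \sum_f G f.

Lemma card_colouring_gt0 : 0 < #|{ffun T -> C}|%:R :> R.
Proof.
rewrite ltr0n card_ffun expn_gt0; apply/orP; left; exact: C_gt0.
Qed.

Lemma eq_avg G H : G =1 H -> avg G = avg H.
Proof. by move=> e; congr (_ * _); apply: eq_bigr => f _. Qed.

Lemma avgD G H : avg (fun f => G f + H f) = avg G + avg H.
Proof. by rewrite /avg big_split mulrDr. Qed.

Lemma avgZ a G : avg (fun f => a * G f) = a * avg G.
Proof. by rewrite /avg -mulr_sumr mulrCA. Qed.

Lemma avgB G H : avg (fun f => G f - H f) = avg G - avg H.
Proof. by rewrite /avg sumrB mulrBr. Qed.

Lemma avg_sum (I : Type) (s : seq I) (P : pred I) (G : I -> {ffun T -> C} -> R) :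
  avg (fun f => \sum_(i <- s | P i) G i f) = \sum_(i <- s | P i) avg (G i).
Proof. by rewrite /avg exchange_big mulr_sumr. Qed.

Lemma avg_cst a : avg (fun=> a) = a.
Proof.
rewrite /avg sumr_const -[a *+ _]mulr_natl mulrA mulVf ?mul1r //.
by rewrite gt_eqF // card_colouring_gt0.
Qed.

Lemma ler_avg G H : (forall f, G f <= H f) -> avg G <= avg H.
Proof.
move=> le_GH; rewrite /avg ler_wpM2l ?invr_ge0 ?ler0n //.
by apply: ler_sum => f _.
Qed.

Lemma avg_ge0 G : (forall f, 0 <= G f) -> 0 <= avg G.
Proof.
by move=> G0; rewrite /avg mulr_ge0 ?invr_ge0 ?ler0n // sumr_ge0.
Qed.

Lemma ler_norm_avg G : `|avg G| <= avg (fun f => `|G f|).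
Proof.
rewrite /avg normrM ger0_norm ?invr_ge0 ?ler0n //.
by rewrite ler_wpM2l ?invr_ge0 ?ler0n // ler_norm_sum.
Qed.

Lemma avg_eq0 G : (forall f, 0 <= G f) -> avg G = 0 -> forall f, G f = 0.
Proof.
move=> G0 /eqP; rewrite mulf_eq0 invr_eq0 gt_eqF ?card_colouring_gt0 //=.
by rewrite psumr_eq0 // => /allP G00 f; apply/eqP/(implyP (G00 f _));
    rewrite ?mem_index_enum.
Qed.

Lemma exists_ge_avg G : exists f, avg G <= G f.
Proof.
have [c] : exists c : C, c \in C by apply/card_gt0P.
move=> _; pose f0 : {ffun T -> C} := [ffun=> c].
pose f1 := [arg max_(f > f0) G f]%O.
exists f1; rewrite -[leRHS]avg_cst; apply: ler_avg => f.
by rewrite /f1; case: arg_maxP => // i _; apply.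
Qed.

Definition recolour f v c : {ffun T -> C} := [ffun w => if w == v then c else f w].

Definition indep_of v G := forall f c, G (recolour f v c) = G f.

(** Exchanging [f v] with an extra independent colour is an involution on pairs of a colouring and a
    colour, so the colour of [v] can be averaged out on its own. *)
Lemma avg_indep0 v (phi : C -> R) G :
  \sum_c phi c = 0 -> indep_of v G -> avg (fun f => phi (f v) * G f) = 0.
Proof.
move=> phi0 Gv; rewrite /avg; apply/eqP; rewrite mulf_eq0; apply/orP; right.
pose H f := phi (f v) * G f.
have: #|C|%:R * \sum_f H f = 0.
  transitivity (\sum_f \sum_(c : C) H f).
    rewrite mulr_sumr; apply: eq_bigr => f _.
    by rewrite sumr_const mulr_natl.
  rewrite pair_big /=.
  pose h (x : {ffun T -> C} * C) := (recolour x.1 v x.2, x.1 v).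
  have hK : involutive h.
    move=> [f c]; rewrite /h /=; congr (_, _); last by rewrite ffunE eqxx.
    by apply/ffunP => w; rewrite !ffunE; case: eqP => // ->.
  rewrite (reindex_inj (inv_inj hK)) /=.
  rewrite -(pair_bigA _ (fun f c => H (recolour f v c))) /=.
  rewrite big1 // => f _; rewrite /H.
  under eq_bigr do rewrite ffunE eqxx Gv.
  by rewrite -mulr_suml phi0 mul0r.
by move/eqP; rewrite mulf_eq0 pnatr_eq0 eqn0Ngt C_gt0 /=.
Qed.

End Average.

(** * Elementary inequalities behind hypercontractivity *)

Section Convexity.
Variable R : realFieldType.

Lemma convex_exp (q : nat) (s x y : R) : 0 <= s <= 1 -> 0 <= x -> 0 <= y ->
  (s * x + (1 - s) * y) ^+ q <= s * x ^+ q + (1 - s) * y ^+ q.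
Proof.
move=> /andP[s0 s1] x0 y0; elim: q => [|q IH]; first by rewrite !expr0; lra.
have s0' : 0 <= 1 - s by lra.
rewrite exprSr; apply: (le_trans (y := (s * x ^+ q + (1 - s) * y ^+ q) * (s * x + (1 -
    s) * y))).
  by rewrite ler_wpM2r // addr_ge0 // mulr_ge0.
have mono : 0 <= (x ^+ q - y ^+ q) * (x - y).
  case: (leP y x) => [lyx|/ltW lxy].
    by rewrite mulr_ge0 // subr_ge0 // lerXn2r // nnegrE.
  by rewrite mulr_le0 // subr_le0 // lerXn2r // nnegrE.
rewrite !exprSr -subr_ge0.
have -> : s * (x ^+ q * x) + (1 - s) * (y ^+ q * y)
   - (s * x ^+ q + (1 - s) * y ^+ q) * (s * x + (1 - s) * y)
   = s * (1 - s) * ((x ^+ q - y ^+ q) * (x - y)) by ring.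
by rewrite mulr_ge0 // mulr_ge0.
Qed.

Lemma sum_even_terms (q : nat) (u : nat -> R) :
  \sum_(i < q.*2.+1) (if odd i then 0 else u i./2) = \sum_(i < q.+1) u i.
Proof.
elim: q => [|q IH]; first by rewrite !big_ord1.
rewrite doubleS big_ord_recr big_ord_recr /= IH.
by rewrite odd_double /= addr0 doubleK [RHS]big_ord_recr.
Qed.

(** Source of the factor [(2q)^2] per variable in the hypercontractive bound; crude, but dependent
    on [q] alone. *)
Lemma bin_double_le (q i : nat) : ('C(q.*2, i.*2) <= (q.*2 ^ 2) ^ i)%N.
Proof.
have H n m : ('C(n, m) <= n ^ m)%N.
  elim: m n => [|m IH] n; first by rewrite bin0.
  case: n => [|n]; first by rewrite bin0n.
  rewrite -(leq_pmul2l (m := m.+1)) // -mul_bin_diag expnS.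
  rewrite mulnCA leq_mul // (leq_trans (IH n)) //.
  rewrite (leq_trans _ (leq_pmull _ _)) //; case: m {IH} => // m; by rewrite leq_exp2r.
by rewrite -expnM mul2n.
Qed.
End Convexity.

(** * Hypercontractivity *)

Lemma big_subsetU1 (R : zmodType) (T : finType) (A : {set T}) (v : T)
    (F : {set T} -> R) : v \in A ->
  \sum_(S : {set T} | S \subset A) F S =
  \sum_(S : {set T} | S \subset A :\ v) F S
  + \sum_(S : {set T} | S \subset A :\ v) F (v |: S).
Proof.
move=> vA; rewrite (bigID (fun S : {set T} => v \in S)) /= addrC; congr (_ + _).
  by apply: eq_bigl => S; rewrite subsetD1.
rewrite (reindex_onto (fun S => v |: S) (fun S => S :\ v)) /=.
  apply: eq_bigl => S; rewrite setU11 andbT subUset sub1set vA /= subsetD1.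
  case vS: (v \in S); rewrite ?(andbT, andbF); last by rewrite setU1K ?vS ?eqxx ?andbT.
  by apply/negP => /andP[_ /eqP e]; move: vS; rewrite -e !inE eqxx.
by move=> S /andP[_ vS]; rewrite setD1K.
Qed.

Section Hypercontractivity.
Variables (R : realFieldType) (T : finType) (C : finType).
Hypothesis C_gt0 : (0 < #|C|)%N.
Variable chi : T -> C -> R.
Hypothesis chi_odd : forall v i, odd i -> \sum_c chi v c ^+ i = 0.
Hypothesis chi_le1 : forall v c, `|chi v c| <= 1.
Implicit Types (f : {ffun T -> C}) (G H : {ffun T -> C} -> R) (S A : {set T}).

Definition mon S f : R := \prod_(v in S) chi v (f v).

Lemma chi_sum0 v : \sum_c chi v c = 0.
Proof. by rewrite -[RHS](@chi_odd v 1). Qed.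

Lemma monU1 v S f : v \notin S -> mon (v |: S) f = chi v (f v) * mon S f.
Proof. by move=> vS; rewrite /mon big_setU1. Qed.

Lemma mon_indep v S : v \notin S -> indep_of v (mon S).
Proof.
move=> vS f c; apply: eq_bigr => w wS; rewrite ffunE; case: eqP => // e.
by rewrite -e wS in vS.
Qed.

Lemma norm_mon_le1 S f : `|mon S f| <= 1.
Proof.
by rewrite /mon normr_prod prodr_ile1 // => v _; rewrite normr_ge0 chi_le1.
Qed.

(** Minkowski's inequality for the [q]-norm without roots: [a] and [b] bound the two norms.
    Convexity is applied to [G / a] and [H / b] with weight [a / (a + b)], so zero bounds are
    treated apart. *)
Lemma avg_Minkowski q G H (a b : R) : (0 < q)%N ->
  (forall f, 0 <= G f) -> (forall f, 0 <= H f) -> 0 <= a -> 0 <= b ->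
  avg (fun f => G f ^+ q) <= a ^+ q -> avg (fun f => H f ^+ q) <= b ^+ q ->
  avg (fun f => (G f + H f) ^+ q) <= (a + b) ^+ q.
Proof.
move=> q0 G0 H0 a0 b0 Ga Hb.
have zero (g : {ffun T -> C} -> R) : (forall f, 0 <= g f) -> avg (fun f => g f ^+ q) <=
    0 ^+ q ->
    forall f, g f = 0.
  move=> g0; rewrite expr0n gtn_eqF //= => le0 f.
  suff /eqP : g f ^+ q = 0 by rewrite expf_eq0 q0 => /eqP.
  apply: (avg_eq0 C_gt0 (G := fun f => g f ^+ q)).
    by move=> f'; rewrite exprn_ge0.
  by apply/le_anti; rewrite le0 avg_ge0 // => f'; rewrite exprn_ge0.
have [a00|a_neq0] := eqVneq a 0.
  rewrite a00 in Ga; rewrite a00 add0r.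
  by under eq_avg => f do rewrite (zero G G0 Ga) add0r.
have [b00|b_neq0] := eqVneq b 0.
  rewrite b00 in Hb; rewrite b00 addr0.
  by under eq_avg => f do rewrite (zero H H0 Hb) addr0.
have ap : 0 < a by rewrite lt_def a_neq0.
have bp : 0 < b by rewrite lt_def b_neq0.
have abp : 0 < a + b by rewrite addr_gt0.
pose s := a / (a + b).
have s01 : 0 <= s <= 1.
  by rewrite /s divr_ge0 ?(ltW abp) //= ler_pdivrMr // mul1r lerDl ltW.
have s1 : 1 - s = b / (a + b) by rewrite /s; field; lra.
have pt f : (G f + H f) ^+ q <=
    (a + b) ^+ q * (s * (a ^- q * G f ^+ q) + (1 - s) * (b ^- q * H f ^+ q)).
  rewrite -!exprVn -!exprMn.
  have -> : G f + H f = (a + b) * (s * (a^-1 * G f) + (1 - s) * (b^-1 * H f)).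
    by rewrite s1 /s; field; rewrite !gt_eqF.
  rewrite [leLHS]exprMn ler_wpM2l ?exprn_ge0 ?(ltW abp) //.
  by apply: convex_exp; rewrite // mulr_ge0 // invr_ge0 ltW.
apply: (le_trans (ler_avg pt)).
rewrite avgZ avgD !avgZ -[leRHS]mulr1 ler_wpM2l ?exprn_ge0 ?(ltW abp) //.
have e1 : s * 1 + (1 - s) * 1 = 1 by ring.
rewrite -[leRHS]e1.
have [? ?] := andP s01.
by rewrite lerD // ler_wpM2l ?subr_ge0 // ler_pdivrMl ?exprn_gt0 // mulr1.
Qed.

(** In the binomial expansion the odd powers of [chi v] average to zero and the even ones are at
    most 1; what is left is compared term by term with the expansion of the right-hand side. *)
Lemma avg_two_point q v G H : indep_of v G -> indep_of v H ->
  avg (fun f => (G f + chi v (f v) * H f) ^+ q.*2) <=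
  avg (fun f => (G f ^+ 2 + (q.*2 ^ 2)%:R * H f ^+ 2) ^+ q).
Proof.
move=> Gv Hv.
pose t (i : nat) f : R := (G f ^+ (q.*2 - i) * (chi v (f v) * H f) ^+ i) *+ 'C(q.*2, i).
pose u (i : nat) f : R := ((G f ^+ 2) ^+ (q - i) * (H f ^+ 2) ^+ i) *+ 'C(q.*2, i.*2).
have -> : avg (fun f => (G f + chi v (f v) * H f) ^+ q.*2) =
    \sum_(i < q.*2.+1) avg (t i).
  by rewrite -avg_sum; apply: eq_avg => f; rewrite exprDn.
apply: (le_trans (y := \sum_(i < q.*2.+1) (if odd i then 0 else avg (u i./2)))).
  apply: ler_sum => -[i /= ltiq] _; case: ifP => oddi.
    have -> : avg (t i) = avg (fun f => chi v (f v) ^+ i *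
        ((G f ^+ (q.*2 - i) * H f ^+ i) *+ 'C(q.*2, i))).
      apply: eq_avg => f; rewrite /t exprMn mulrnAr; congr (_ *+ _); ring.
    rewrite (avg_indep0 C_gt0 (phi := fun c => chi v c ^+ i)) ?chi_odd // => f c.
    by rewrite Gv Hv.
  apply: ler_avg => f; rewrite /t /u halfK oddi subn0.
  rewrite lerMn2r; apply/orP; right.
  have e2 : i = (i./2).*2 by rewrite halfK oddi subn0.
  have -> : (q.*2 - i)%N = (q - i./2).*2 by rewrite doubleB -e2.
  rewrite {2}e2 -!muln2 -!(mulnC 2) !exprM ler_wpM2l //.
    by rewrite exprn_ge0 // sqr_ge0.
  rewrite lerXn2r ?nnegrE ?sqr_ge0 // exprMn ler_piMl ?sqr_ge0 //.
  by rewrite -real_normK ?num_real // exprn_ile1.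
rewrite (sum_even_terms q (fun i => avg (u i))) -avg_sum.
apply: ler_avg => f; rewrite exprDn.
apply: ler_sum => -[i /= ltiq] _; rewrite /u.
set x := (G f ^+ 2) ^+ _; set y := (H f ^+ 2) ^+ i; set c := 'C(q, i).
have -> : x * ((q.*2 ^ 2)%:R * H f ^+ 2) ^+ i *+ c = x * y * ((q.*2 ^ 2)%:R ^+ i *+ c).
  by rewrite exprMn -/y -mulr_natr -[in RHS]mulr_natr; ring.
rewrite -[leLHS]mulr_natr ler_wpM2l //.
  by rewrite mulr_ge0 // exprn_ge0 // sqr_ge0.
rewrite -natrX -mulrnA ler_nat (leq_trans (bin_double_le _ _)) // leq_pmulr //.
by rewrite bin_gt0 -ltnS.
Qed.

(** Induction on [A]: splitting off [v] writes the polynomial as [g + chi_v h] with [g], [h]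
    independent of [v]. The two-point bound followed by Minkowski for [g^2] and a multiple of [h^2]
    reduces to [A :\ v]. *)
Theorem hypercontractivity q A (a : {set T} -> R) : (0 < q)%N ->
  avg (fun f => (\sum_(S : {set T} | S \subset A) a S * mon S f) ^+ q.*2) <=
  (\sum_(S : {set T} | S \subset A) ((q.*2 ^ 2) ^ #|S|)%:R * a S ^+ 2) ^+ q.
Proof.
move=> q0; move e: #|A| => n; elim: n A e a => [|n IH] A cardA a.
  have /eqP -> : A == set0 by rewrite -cards_eq0 cardA.
  have e S : (S \subset set0) = (S == set0) by rewrite subset0.
  under eq_avg => f do rewrite (eq_bigl _ _ e) big_pred1_eq /mon big_set0 mulr1.
  rewrite (eq_bigl _ _ e) big_pred1_eq cards0 expn0 mul1r avg_cst //.
  by rewrite -exprM mul2n.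
have /card_gt0P[v vA] : (0 < #|A|)%N by rewrite cardA.
have cardAv : #|A :\ v| = n by move: cardA; rewrite (cardsD1 v) vA => -[].
pose g f := \sum_(S : {set T} | S \subset A :\ v) a S * mon S f.
pose h f := \sum_(S : {set T} | S \subset A :\ v) a (v |: S) * mon S f.
have notv S : S \subset A :\ v -> v \notin S.
  by rewrite subsetD1 => /andP[].
have -> : avg (fun f => (\sum_(S : {set T} | S \subset A) a S * mon S f) ^+ q.*2)
    = avg (fun f => (g f + chi v (f v) * h f) ^+ q.*2).
  apply: eq_avg => f; rewrite (big_subsetU1 _ vA); congr ((_ + _) ^+ _).
  by rewrite mulr_sumr; apply: eq_bigr => S SA; rewrite monU1 ?notv // mulrCA.
have indep_sum b : indep_of v (fun f =>
    \sum_(S : {set T} | S \subset A :\ v) b S * mon S f).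
  by move=> f c; apply: eq_bigr => S SA; rewrite mon_indep ?notv.
apply: (le_trans (avg_two_point _ (indep_sum _) (indep_sum _))).
pose K : R := (q.*2 ^ 2)%:R.
pose N (b : {set T} -> R) := \sum_(S : {set T} | S \subset A :\ v) ((q.*2 ^ 2) ^
    #|S|)%:R * b S ^+ 2.
have N_ge0 b : 0 <= N b by apply: sumr_ge0 => S _; rewrite mulr_ge0 ?ler0n ?sqr_ge0.
have -> : \sum_(S : {set T} | S \subset A) ((q.*2 ^ 2) ^ #|S|)%:R * a S ^+ 2 =
    N a + K * N (fun S => a (v |: S)).
  rewrite (big_subsetU1 _ vA); congr (_ + _).
  rewrite mulr_sumr; apply: eq_bigr => S SA.
  by rewrite cardsU1 notv // add1n expnS natrM mulrA.
have IH' b : avg (fun f => ((\sum_(S : {set T} | S \subset A :\ v) b S * mon S f) ^+ 2)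
    ^+ q) <= N b ^+ q.
  by under eq_avg => f do rewrite -exprM mul2n; exact: IH.
apply: avg_Minkowski => //.
- by move=> f; rewrite sqr_ge0.
- by move=> f; rewrite mulr_ge0 ?ler0n ?sqr_ge0.
- by rewrite mulr_ge0 // ler0n.
- under eq_avg => f do rewrite exprMn.
  by rewrite avgZ exprMn ler_wpM2l // exprn_ge0 // ler0n.
Qed.

End Hypercontractivity.

(** * Counting tuples of linked sets *)

Lemma card_cover_le (R : realFieldType) (I X : finType) (P : {set I})
    (F : {set X}) (G : I -> {set X}) (b : R) :
  (forall x, x \in F -> exists2 i, i \in P & x \in G i) ->
  (forall i, i \in P -> #|G i|%:R <= b) -> #|F|%:R <= #|P|%:R * b.
Proof.
move=> cov Gb; apply: (le_trans (y := (\sum_(i in P) #|G i|)%:R)).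
  rewrite ler_nat; apply: (@leq_trans #|\bigcup_(i in P) G i|).
    apply: subset_leq_card; apply/subsetP => x /cov[i iP xi].
    by apply/bigcupP; exists i.
  elim/big_ind2: _ => [|D n D' n' Dn Dn'|//]; first by rewrite cards0.
  exact: leq_trans (leq_card_setU _ _) (leq_add Dn Dn').
rewrite natr_sum mulr_natl -sumr_const.
exact: ler_sum.
Qed.

Lemma card_split_le (X : finType) (F : {set X}) (p q : pred X) :
  (#|[set x in F | p x]| <= #|[set x in F | p x && q x]| + #|[set x in F | p x && ~~ q
      x]|)%N.
Proof.
apply: leq_trans (leq_card_setU _ _); apply/subset_leq_card/subsetP => x.
by rewrite !inE => /andP[-> ->]; case: q.
Qed.

(** The cost of one set of a tuple. For touching tuples, [kappa ^ 2] bounds the choices of an apex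
    and a vertex of [K] in its set; [C0] stands for the case that the rest touches, [2 ^ kappa] for
    a set inside [K]. The last [C0] is for tuples that do not touch. *)
Definition fam_const (R : realFieldType) (kappa : nat) (C0 : R) : R :=
  (kappa ^ 2)%:R * (C0 + (2 ^ kappa)%:R) + C0.

Section CountingFamilies.
Variables (R : realFieldType) (T : finType).
Variables (SS : {set {set T}}) (apex : {set T} -> T).
Implicit Types (g : {ffun T -> {set T}}) (K J S Q : {set T}) (v w x : T).

Definition link v : {set {set T}} := [set S in SS | apex S == v].

(* The tuples of members of [SS] with prescribed apexes, in which no vertex
   outside [K] is covered exactly once: only these contribute to a mixed moment
   of the mean-zero variables attached to the vertices. *)
Definition fam K J : {set {ffun T -> {set T}}} :=
  [set g : {ffun T -> {set T}} | [forall v, if v \in J then g v \in link v else g v ==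
      set0]
           && [forall x, (x \notin K) ==> (#|[set v | x \in g v]| != 1%N)]].

Definition touches K g := [exists v, [exists x, (x \in g v) && (x \in K)]].

Definition erase g v : {ffun T -> {set T}} :=
  [ffun w => if w == v then set0 else g w].

Lemma famP K J g : reflect
  [/\ forall v, v \in J -> g v \in link v, forall v, v \notin J -> g v = set0
    & forall x, x \notin K -> #|[set v | x \in g v]| <> 1%N] (g \in fam K J).
Proof.
rewrite [_ \in _]inE; apply: (iffP andP) => [[/forallP H1 /forallP H2]|[H1 H2 H3]];
    split.
- by move=> v vJ; move: (H1 v); rewrite vJ.
- by move=> v vJ; move: (H1 v); rewrite (negPf vJ) => /eqP.
- by move=> x xK; apply/eqP; move: (H2 x); rewrite xK.
- by apply/forallP => v; case: ifP => [/H1//|/negbT/H2 ->].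
- by apply/forallP => x; apply/implyP => /H3/eqP.
Qed.

Lemma touchesP K g :
  reflect (exists v x, x \in g v /\ x \in K) (touches K g).
Proof.
apply: (iffP existsP) => [[v /existsP[x /andP[? ?]]]|[v [x [? ?]]]].
  by exists v, x.
by exists v; apply/existsP; exists x; apply/andP.
Qed.

(** The vertices of the erased set lose one covering and may now be covered just once; moving them
    into [K] exempts them. *)
Lemma fam_erase K J g v : v \in J -> g \in fam K J ->
  erase g v \in fam (K :|: g v) (J :\ v).
Proof.
move=> vJ /famP[H1 H2 H3]; apply/famP; split.
- by move=> w; rewrite !inE ffunE => /andP[/negPf -> /H1]; rewrite inE.
- by move=> w; rewrite !inE ffunE negb_and negbK; case: eqP => //= _ /H2.
- move=> x; rewrite inE negb_or => /andP[xK xv];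
    have <- : #|[set w | x \in g w]| = #|[set w | x \in erase g v w]|; last exact: H3.
  by apply: eq_card => w; rewrite !inE ffunE; case: eqP => // ->;
      rewrite inE (negPf xv).
Qed.

Lemma fam_other K J g v x : g \in fam K J -> x \in g v -> x \notin K ->
  exists2 w, w != v & x \in g w.
Proof.
move=> /famP[_ _ H3] xv xK; have := H3 x xK.
case: (pickP (fun w => (w != v) && (x \in g w))) => [w /andP[? ?] _|none []].
  by exists w.
apply/eqP/cards1P; exists v; apply/setP => w; rewrite !inE.
by case: eqP => [->//|/eqP wv]; move: (none w); rewrite wv.
Qed.

Lemma card_erase_le (F : {set {ffun T -> {set T}}}) v (D : {set {set T}}) (b : R) :
  (forall g, g \in F -> g v \in D) ->
  (forall S, S \in D -> #|[set erase g v | g in F & g v == S]|%:R <= b) ->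
  #|F|%:R <= #|D|%:R * b.
Proof.
move=> FD Fb; apply: (card_cover_le (G := fun S => [set g in F | g v == S])).
  by move=> g gF; exists (g v); rewrite ?FD // inE gF eqxx.
move=> S SD; apply: le_trans (Fb S SD).
rewrite card_in_imset => [|g h]; first by rewrite ler_nat subset_leq_card //;
    apply/subsetP => g; rewrite !inE.
rewrite !inE => /andP[_ /eqP gv] /andP[_ /eqP hv] e.
apply/ffunP => w; have [->|wv] := eqVneq w v; first by rewrite gv hv.
by move/ffunP/(_ w): e; rewrite !ffunE (negPf wv).
Qed.

Variables (A B C0 : R) (s j0 kappa : nat).
Hypotheses (A_ge1 : 1 <= A) (B_ge1 : 1 <= B) (C0_ge1 : 1 <= C0) (s_gt0 : (0 < s)%N).
Hypothesis card_SS : forall S, S \in SS -> #|S| = s.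
Hypothesis link1 : forall v, #|link v|%:R <= C0 * A ^+ 2.
Hypothesis link2 : forall v x, #|[set S in link v | x \in S]|%:R <= C0 * A.
Hypothesis link3 : forall v Q, (s <= j0 * #|Q|)%N ->
  #|[set S in link v | Q \subset S]|%:R <= C0 * B.

Local Notation Gt := ((kappa ^ 2)%:R * (C0 + (2 ^ kappa)%:R)).
Local Notation G := (fam_const kappa C0).

Let A_gt0 : 0 < A. Proof. exact: lt_le_trans ltr01 A_ge1. Qed.
Let C0_ge0 : 0 <= C0. Proof. exact: le_trans ler01 C0_ge1. Qed.
Let Gt_ge0 : 0 <= Gt.
Proof. by rewrite mulr_ge0 ?addr_ge0 ?ler0n. Qed.
Let G_ge1 : 1 <= G. Proof. exact: le_trans C0_ge1 (ler_wpDl Gt_ge0 (lexx _)). Qed.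
Let GA_ge0 n : 0 <= G ^+ n * A ^+ n.
Proof. by rewrite mulr_ge0 // exprn_ge0 // ltW // (lt_le_trans ltr01 G_ge1). Qed.

Lemma card_link_S v S : S \in link v -> #|S| = s.
Proof. by rewrite inE => /andP[/card_SS]. Qed.

(* A set with prescribed apex that meets what is already covered can be chosen in
   at most [C0 * A] ways.  A set [S] disjoint from it costs [C0 * A ^+ 2], but the
   vertices of [S] have to be covered again, so that the remaining sets touch; and
   if the remaining sets do not touch after some choice, that choice was contained
   in the covered part.  Hence touching families save a factor [A]. *)
Lemma card_fam_aux n K J : #|J| = n -> (#|K| + s * n <= kappa)%N ->
  A * #|[set g in fam K J | touches K g]|%:R <= G ^+ n * A ^+ n /\
  #|fam K J|%:R <= G ^+ n * A ^+ n.
Proof.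
elim: n K J => [|n IH] K J cardJ bound.
  have J0 : J = set0 by apply/eqP; rewrite -cards_eq0 cardJ.
  split; last first.
    rewrite !expr0 mulr1 -[1]/(1%:R) ler_nat -(cards1 ([ffun=>
        set0] : {ffun T -> {set T}})).
    apply: subset_leq_card; apply/subsetP => g /famP[_ H2 _]; rewrite inE.
    by apply/eqP/ffunP => v; rewrite ffunE H2 // J0 inE.
  rewrite (_ : [set _ in _ | _] = set0) ?cards0 ?mulr0 ?GA_ge0 //.
  apply/setP => g; rewrite in_set0 inE; apply/negP =>
      /andP[/famP[_ H2 _] /touchesP[v [x [+ _]]]].
  by rewrite H2 ?J0 ?inE.
(* [#|K| + s * #|J|] does not grow under erasure, so a single [kappa] serves the whole induction. *)
have bound' v S : v \in J -> S \in link v ->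
    #|J :\ v| = n /\ (#|K :|: S| + s * n <= kappa)%N.
  move=> vJ SL; split; first by move: cardJ; rewrite (cardsD1 v) vJ => -[].
  apply: leq_trans bound; rewrite mulnS addnA leq_add2r.
  by rewrite -(card_link_S SL) leq_card_setU.
have touch : A * #|[set g in fam K J | touches K g]|%:R <= Gt * (G ^+ n * A ^+ n.+1).
  pose b : R := C0 * (G ^+ n * A ^+ n) + (2 ^ kappa)%:R * (G ^+ n * A ^+ n).
  apply: (le_trans (y := A * (#|setX J K|%:R * b))).
    rewrite ler_wpM2l ?(ltW A_gt0) //.
    apply: (card_cover_le (G := fun i : T * T => [set g in fam K J | i.2 \in g i.1])).
      move=> g; rewrite in_set => /andP[gF /touchesP[v [x [xv xK]]]]; exists (v, x);
          last by rewrite in_set gF.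
      rewrite inE /= xK andbT; apply/negPn/negP => vJ.
      by case/famP: gF => _ /(_ v vJ) gv _; rewrite gv inE in xv.
    case=> v x; rewrite inE /= => /andP[vJ xK].
    have := card_split_le (fam K J) (fun g => x \in g v)
      (fun g => touches (K :|: g v) (erase g v)).
    rewrite -(ler_nat R) natrD; move/le_trans; apply.
    rewrite /b lerD //.
      apply: (le_trans (y := #|[set S in link v | x \in S]|%:R * (G ^+ n * A ^+ n /
          A))).
        apply: (card_erase_le (v := v)) => [g|S].
          by rewrite in_set => /and3P[/famP[H1 _ _] xv _]; rewrite in_set H1.
        rewrite in_set => /andP[SL xS]; have [cJ bd] := bound' v S vJ SL.
        rewrite ler_pdivlMr // mulrC; apply: le_trans (IH _ _ cJ bd).1.
        rewrite ler_wpM2l ?(ltW A_gt0) // ler_nat subset_leq_card //.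
        apply/subsetP => _ /imsetP[g + ->]; rewrite in_set => /andP[+ /eqP gv].
        by rewrite in_set => /and3P[gF xv tg]; rewrite in_set -gv tg andbT fam_erase.
      rewrite mulrA ler_pdivrMr // mulrAC ler_wpM2r //.
    apply: (le_trans (y := #|powerset K|%:R * (G ^+ n * A ^+ n))).
      apply: (card_erase_le (v := v)) => [g|S].
        rewrite in_set => /and3P[gF xv /touchesP nt]; rewrite inE; apply/subsetP =>
            y yv.
        apply/negPn/negP => yK; apply: nt.
        have [w wv yw] := fam_other gF yv yK.
        by exists w, y; rewrite ffunE (negPf wv) yw inE yv orbT.
      rewrite inE => SK.
      have [SL|SL] := boolP (S \in link v); last first.
        rewrite (_ : imset _ _ = set0) ?cards0 ?GA_ge0 //.
        apply/setP => h; rewrite in_set0; apply/negP => /imsetP[g + _].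
        rewrite in_set => /andP[+ /eqP gv]; rewrite in_set =>
            /andP[/famP[/(_ v vJ) + _ _] _].
        by rewrite gv (negPf SL).
      have [cJ bd] := bound' v S vJ SL.
      apply: le_trans (IH _ _ cJ bd).2; rewrite ler_nat subset_leq_card //.
      apply/subsetP => _ /imsetP[g + ->]; rewrite in_set => /andP[+ /eqP gv].
      by rewrite in_set => /and3P[gF xv tg]; rewrite -gv fam_erase.
    rewrite ler_wpM2r // ler_nat card_powerset leq_exp2l //.
    by apply: leq_trans bound; rewrite leq_addr.
  rewrite cardsX cardJ /b -mulrDl exprSr.
  have -> : Gt * (G ^+ n * (A ^+ n * A)) = A * ((kappa ^ 2)%:R * ((C0 + (2 ^ kappa)%:R)
      * (G ^+ n * A ^+ n))).
    by move: (G ^+ n) (C0 + _) => g0 c; ring.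
  rewrite ler_wpM2l ?(ltW A_gt0) // ler_wpM2r //.
    by rewrite mulr_ge0 // addr_ge0 ?ler0n.
  rewrite ler_nat -mulnn leq_mul //.
    by move: bound; clear -s_gt0; nia.
  by apply: leq_trans bound; rewrite leq_addr.
split.
  apply: (le_trans touch); have -> : G ^+ n.+1 * A ^+ n.+1 = G * (G ^+ n * A ^+ n.+1).
    by rewrite [G ^+ _]exprS mulrA.
  apply: ler_wpM2r; last by rewrite lerDl.
  by rewrite [A ^+ _]exprS mulrCA mulr_ge0 // (ltW A_gt0).
have nontouch : #|[set g in fam K J | ~~ touches K g]|%:R <= C0 * (G ^+ n * A ^+ n.+1).
  have /card_gt0P[v vJ] : (0 < #|J|)%N by rewrite cardJ.
  apply: (le_trans (y := #|link v|%:R * (G ^+ n * A ^+ n / A))).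
    apply: (card_erase_le (v := v)) => [g|S SL].
      by rewrite in_set => /andP[/famP[H1 _ _] _]; rewrite H1.
    have [cJ bd] := bound' v S vJ SL.
    rewrite ler_pdivlMr // mulrC; apply: le_trans (IH _ _ cJ bd).1.
    rewrite ler_wpM2l ?(ltW A_gt0) // ler_nat subset_leq_card //.
    apply/subsetP => _ /imsetP[g + ->]; rewrite in_set => /andP[+ /eqP gv].
    rewrite in_set => /andP[gF /touchesP nt].
    rewrite in_set -gv (fam_erase vJ gF) /=; apply/touchesP.
    have /card_gt0P[x xS] : (0 < #|S|)%N by rewrite (card_link_S SL).
    have xv : x \in g v by rewrite gv.
    have xK : x \notin K by apply/negP => xK; apply: nt; exists v, x.
    have [w wv xw] := fam_other gF xv xK.
    by exists w, x; rewrite ffunE (negPf wv) xw inE xv orbT.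
  rewrite mulrA ler_pdivrMr //.
  have -> : C0 * (G ^+ n * A ^+ n.+1) * A = (C0 * A ^+ 2) * (G ^+ n * A ^+ n).
    by rewrite exprSr; move: (G ^+ n) => g0; ring.
  by rewrite ler_wpM2r.
have := card_split_le (fam K J) xpredT (touches K).
rewrite -(ler_nat R) natrD /=.
have -> : [set g in fam K J | true] = fam K J by apply/setP => g; rewrite in_set andbT.
move/le_trans; apply.
have le1 : #|[set g in fam K J | touches K g]|%:R <= Gt * (G ^+ n * A ^+ n.+1).
  by apply: le_trans touch; rewrite ler_peMl ?ler0n.
have -> : G ^+ n.+1 * A ^+ n.+1 = Gt * (G ^+ n * A ^+ n.+1) + C0 * (G ^+ n * A ^+ n.+1).
  by rewrite -mulrDl mulrA -[Gt + C0]/G -exprS.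
exact: lerD.
Qed.

Lemma card_fam_touch K J : (#|K| + s * #|J| <= kappa)%N ->
  A * #|[set g in fam K J | touches K g]|%:R <= G ^+ #|J| * A ^+ #|J|.
Proof. by case/(card_fam_aux (erefl _)). Qed.

Lemma card_fam_le K J : (#|K| + s * #|J| <= kappa)%N ->
  #|fam K J|%:R <= G ^+ #|J| * A ^+ #|J|.
Proof. by case/(card_fam_aux (erefl _)). Qed.

(* If nothing touches [K], a first set [S] is covered by the at most [j0 - 1] others,
   one of which thus shares [s / j0] vertices with [S] and has only [C0 * B] choices;
   the two sets differ because their apexes do, so the rest must touch them. *)
Lemma card_fam_flat K J : (0 < #|J| <= j0)%N -> (#|K| + s * #|J| <= kappa)%N ->
  A * #|fam K J|%:R <=
  (1 + C0 ^+ 2 * (kappa * 2 ^ kappa)%:R) * G ^+ kappa * B * A ^+ #|J|.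
Proof.
move=> /andP[J_gt0 J_le] bound.
have lt_s_kappa : (s <= kappa)%N.
  by apply: leq_trans bound; rewrite (leq_trans _ (leq_addl _ _)) // leq_pmulr.
have J_kappa : (#|J| <= kappa)%N.
  by apply: leq_trans bound; rewrite (leq_trans _ (leq_addl _ _)) // leq_pmull.
have Gk n : (n <= kappa)%N -> G ^+ n <= G ^+ kappa by move=> le; rewrite ler_weXn2l.
have A0 n : 0 <= A ^+ n by rewrite exprn_ge0 // ltW.
have [v vJ] : exists v, v \in J by apply/card_gt0P.
have nontouch : A * #|[set g in fam K J | ~~ touches K g]|%:R <=
    C0 ^+ 2 * (kappa * 2 ^ kappa)%:R * G ^+ kappa * B * A ^+ #|J|.
  (* [b2] counts the [n] sets left after two have been fixed, with the factor [A] saved by touching;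
     [b1] adds the choice of the second set, through its apex and its trace on the first. *)
  pose n := #|J|.-2.
  pose b2 : R := G ^+ kappa * A ^+ n / A.
  pose b1 : R := (kappa * 2 ^ kappa)%:R * (C0 * B * b2).
  have b2_ge0 : 0 <= b2.
    by rewrite /b2 !mulr_ge0 ?invr_ge0 // ?(ltW A_gt0) // exprn_ge0 // (le_trans ler01
        G_ge1).
  have B_ge0 : 0 <= B by exact: le_trans ler01 B_ge1.
  have b1_ge0 : 0 <= b1 by rewrite /b1 mulr_ge0 ?ler0n // mulr_ge0 // mulr_ge0.
  (* A single set outside [K] has no other set to cover its vertices again, so there is no such
     tuple. *)
  case J1 : (#|J| == 1)%N.
    rewrite (_ : [set g in _ | _] = set0) ?cards0 ?mulr0.
      rewrite !mulr_ge0 ?ler0n ?A0 ?exprn_ge0 ?(le_trans ler01 G_ge1) ?(le_trans ler01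
          B_ge1) //.
    apply/setP => g; rewrite in_set0 in_set; apply/negP => /andP[gF /touchesP nt].
    have SL : g v \in link v by case/famP: gF => + _ _; apply.
    have /card_gt0P[x xv] : (0 < #|g v|)%N by rewrite (card_link_S SL).
    have xK : x \notin K by apply/negP => xK; apply: nt; exists v, x.
    have [w wv xw] := fam_other gF xv xK.
    have wJ : w \notin J.
      by apply/negP => wJ; move: J1; rewrite (cardsD1 v) vJ (cardsD1 w) !inE wv wJ.
    by case/famP: gF => _ /(_ w wJ) gw _; rewrite gw inE in xw.
  have cJ : #|J| = n.+2 by move: J1 J_gt0; rewrite /n; case: #|J| => [|[]].
  have -> : C0 ^+ 2 * (kappa * 2 ^ kappa)%:R * G ^+ kappa * B * A ^+ #|J|
      = A * (C0 * A ^+ 2 * b1).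
    rewrite cJ /b1 /b2 !exprSr; field; exact: lt0r_neq0.
  rewrite ler_wpM2l ?(ltW A_gt0) //.
  apply: (le_trans (y := #|link v|%:R * b1)); last first.
    by rewrite ler_wpM2r.
  apply: (card_erase_le (v := v)) => [g|S SL].
    by rewrite in_set => /andP[/famP[H1 _ _] _]; rewrite H1.
  have cS : #|S| = s by apply: card_link_S SL.
  pose P := setX (J :\ v) (powerset S).
  pose F (i : T * {set T}) := if (s <= j0 * #|i.2|)%N then
    [set g in fam (K :|: S) (J :\ v) | (i.2 \subset g i.1)
       && touches (K :|: S :|: g i.1) (erase g i.1)] else set0.
  apply: (le_trans (y := #|P|%:R * (C0 * B * b2))); last first.
    apply: ler_wpM2r; first by rewrite mulr_ge0 // mulr_ge0.
    rewrite ler_nat cardsX card_powerset cS leq_mul ?leq_exp2l //.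
    by rewrite (leq_trans _ J_kappa) // subset_leq_card // subsetDl.
  apply: (card_cover_le (G := F)) => [h|].
    case/imsetP => g + ->; rewrite in_set => /andP[+ /eqP gv].
    rewrite in_set => /andP[gF /touchesP nt].
    have ntv x : x \in S -> x \notin K.
      by move=> xS; apply/negP => xK; apply: nt; exists v, x; rewrite gv.
    have SU : S \subset \bigcup_(w in J :\ v) (S :&: g w).
      apply/subsetP => x xS; have xv : x \in g v by rewrite gv.
      have [w wv xw] := fam_other gF xv (ntv x xS).
      apply/bigcupP; exists w; rewrite !inE ?xS // wv /=.
      by apply/negPn/negP => wJ; case/famP: gF => _ /(_ w wJ) gw _;
          rewrite gw inE in xw.
    have [w wJ big] : exists2 w, w \in J :\ v & (s <= j0 * #|S :&: g w|)%N.
      case: (pickP (fun w => (w \in J :\ v) && (s <= j0 * #|S :&: g w|)%N)) =>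
          [w /andP[? ?]|none].
        by exists w.
      have small w : w \in J :\ v -> (j0 * #|S :&: g w| < s)%N.
        by move=> wJ; rewrite ltnNge; move: (none w); rewrite wJ /= => ->.
      exfalso.
      have : (s <= \sum_(w in J :\ v) #|S :&: g w|)%N.
        rewrite -{1}cS; apply: leq_trans (subset_leq_card SU) _.
        elim/big_ind2: _ => [|D m D' m' Dm Dm'|//]; first by rewrite cards0.
        exact: leq_trans (leq_card_setU _ _) (leq_add Dm Dm').
      rewrite -(leq_pmul2l (m := j0)) ?(leq_trans J_gt0) // big_distrr /=.
      apply/negP; rewrite -ltnNge.
      (* Pigeonhole: at most [j0] numbers, each at most [s - 1], sum to less than [j0 * s]. *)
      apply: (@leq_ltn_trans (\sum_(w in J :\ v) s.-1)).
        by apply: leq_sum => w /small; case: (s) s_gt0.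
      rewrite sum_nat_const; apply: (@leq_ltn_trans (j0 * s.-1)).
        by rewrite leq_mul2r (leq_trans _ J_le) ?orbT // subset_leq_card // subsetDl.
      by rewrite ltn_pmul2l ?(leq_trans J_gt0) //; case: (s) s_gt0.
    have [wv wJ'] : w != v /\ w \in J by move: wJ; rewrite !inE => /andP[].
    exists (w, S :&: g w); first by rewrite inE /= wJ powersetE subsetIl.
    rewrite /F /= big in_set -gv fam_erase //= ffunE (negPf wv) subsetIr /=.
    have wL : g w \in link w by case/famP: gF => + _ _; apply.
    have [x xS xw] : exists2 x, x \in S & x \notin g w.
      apply/subsetPn; apply/negP => Sw.
      have /eqP e : S == g w by rewrite eqEcard Sw cS (card_link_S wL) leqnn.
      move: SL wL; rewrite -e !inE => /andP[_ /eqP ->] /andP[_ /eqP e'].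
      by rewrite e' eqxx in wv.
    have xv : x \in g v by rewrite gv.
    have [y yv xy] := fam_other gF xv (ntv x xS).
    have yw : y != w by apply: contraNneq xw => <-.
    by apply/touchesP; exists y, x; rewrite !ffunE (negPf yw) (negPf yv) xy !inE xv
        orbT.
  case=> w Q; rewrite inE /= powersetE => /andP[wJ QS]; rewrite /F /=.
  case: leqP => [big|_]; last by rewrite cards0 mulr_ge0 // mulr_ge0.
  apply: (le_trans (y := #|[set S in link w | Q \subset S]|%:R * b2)); last first.
    by rewrite ler_wpM2r // link3.
  apply: (card_erase_le (v := w)) => [g|S'].
    by rewrite in_set => /and3P[/famP[H1 _ _] Qg _]; rewrite in_set H1.
  rewrite in_set => /andP[S'L QS']; rewrite /b2 ler_pdivlMr // mulrC.
  have cJw : #|J :\ v :\ w| = n.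
    by move: cJ; rewrite (cardsD1 v) vJ (cardsD1 w) wJ => -[].
  have bd : (#|K :|: S :|: S'| + s * #|J :\ v :\ w| <= kappa)%N.
    rewrite cJw; apply: leq_trans bound; rewrite cJ !mulnS !addnA leq_add2r.
    rewrite (leq_trans (leq_card_setU _ _)) // (card_link_S S'L) leq_add2r.
    by rewrite (leq_trans (leq_card_setU _ _)) // cS.
  apply: (le_trans (y := G ^+ n * A ^+ n)); last first.
    by rewrite ler_wpM2r // Gk // (leq_trans _ J_kappa) // cJ leqW.
  have := card_fam_touch bd; rewrite cJw; apply: le_trans.
  rewrite ler_wpM2l ?(ltW A_gt0) // ler_nat subset_leq_card //.
  apply/subsetP => _ /imsetP[g + ->]; rewrite in_set => /andP[+ /eqP gw].
  by rewrite in_set => /and3P[gF _ tg]; rewrite in_set -gw fam_erase.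
have := card_split_le (fam K J) xpredT (touches K).
rewrite -(ler_nat R) natrD /=.
have -> : [set g in fam K J | true] = fam K J by apply/setP => g; rewrite in_set andbT.
move=> /(ler_wpM2l (ltW A_gt0)) /le_trans; apply.
rewrite mulrDr !mulrDl lerD //.
apply: (le_trans (card_fam_touch bound)).
rewrite mul1r ler_wpM2r // (le_trans (Gk _ J_kappa)) // ler_peMr //.
by rewrite exprn_ge0 // (le_trans ler01 G_ge1).
Qed.

End CountingFamilies.

(** * Tilting the uniform colouring *)

Section Tilting.
Variables (R : realFieldType) (T : finType) (C : finType).
Hypothesis C_gt0 : (0 < #|C|)%N.
Variable chi : T -> C -> R.
Hypothesis chi_odd : forall v i, odd i -> \sum_c chi v c ^+ i = 0.
Hypothesis chi_le1 : forall v c, `|chi v c| <= 1.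
Variables (SS : {set {set T}}) (apex : {set T} -> T).
Variables (A C0 t sg : R) (s k q : nat).
Hypotheses (A_ge1 : 1 <= A) (C0_ge1 : 1 <= C0).
Hypothesis card_SS : forall S, S \in SS -> #|S| = s.
Hypothesis apex_notin : forall S S', S \in SS -> S' \in SS -> apex S \notin S'.
Hypothesis link1 : forall v, #|link SS apex v|%:R <= C0 * A ^+ 2.
Hypothesis sg1 : `|sg| = 1.
Hypothesis t01 : 0 <= t <= 1.
Hypothesis q_gt0 : (0 < q)%N.
Implicit Types (f : {ffun T -> C}) (S Q K e : {set T}) (v w x : T).

Local Notation link := (link SS apex).
Local Notation mon := (mon chi).
Local Notation fam := (fam SS apex).
Local Notation X v f := (chi v (f v)).

Definition tilt v f : R := sg / A * \sum_(S in link v) mon S f.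
(** A value that could make a factor of the density negative is replaced by 0, which keeps the same
    independence from the colours of the apexes. *)
Definition cotilt v f : R := if `|t * tilt v f| <= 1 then tilt v f else 0.

Let A_gt0 : 0 < A. Proof. exact: lt_le_trans ltr01 A_ge1. Qed.
Let C0_ge0 : 0 <= C0. Proof. exact: le_trans ler01 C0_ge1. Qed.

Lemma tilt_le v f : `|tilt v f| <= C0 * A.
Proof.
rewrite /tilt !normrM sg1 mul1r normfV (gtr0_norm A_gt0) ler_pdivrMl //.
apply: le_trans (ler_norm_sum _ _ _) _.
apply: (le_trans (y := \sum_(S in link v) 1)).
  by apply: ler_sum => S _; apply: norm_mon_le1.
by rewrite sumr_const (le_trans (link1 v)) // expr2 mulrCA mulrA.
Qed.

(** Division by [A] makes the squared coefficients sum to at most [C0], by [link1]; hence the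
    moments are bounded independently of [A]. *)
Lemma tilt_moment v :
  avg (fun f => tilt v f ^+ q.*2) <= (((q.*2 ^ 2) ^ s)%:R * C0) ^+ q.
Proof.
pose a (S : {set T}) : R := if S \in link v then sg / A else 0.
have -> : avg (fun f => tilt v f ^+ q.*2) =
    avg (fun f => (\sum_(S : {set T} | S \subset setT) a S * mon S f) ^+ q.*2).
  apply: eq_avg => f; congr (_ ^+ _); rewrite /tilt mulr_sumr big_mkcond /=.
  apply: eq_big => [S|S _]; first by rewrite subsetT.
  by rewrite /a; case: ifP; rewrite ?mul0r.
apply: (le_trans (hypercontractivity C_gt0 chi_odd chi_le1 setT a q_gt0)).
have N0 : 0 <= \sum_(S : {set T} | S \subset setT) ((q.*2 ^ 2) ^ #|S|)%:R * a S ^+ 2.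
  by apply: sumr_ge0 => S _; rewrite mulr_ge0 ?ler0n ?sqr_ge0.
rewrite lerXn2r ?nnegrE ?mulr_ge0 ?ler0n //.
have -> : \sum_(S : {set T} | S \subset setT) ((q.*2 ^ 2) ^ #|S|)%:R * a S ^+ 2 =
    \sum_(S in link v) (((q.*2 ^ 2) ^ s)%:R * A ^- 2).
  rewrite [RHS]big_mkcond /=; apply: eq_big => [S|S _]; first by rewrite subsetT.
  rewrite /a; case: ifP => SL; last by rewrite expr0n mulr0.
  rewrite (card_link_S card_SS SL) expr_div_n.
  by rewrite -[sg ^+ 2]real_normK ?num_real // sg1 expr1n mul1r.
rewrite sumr_const -[leLHS]mulr_natl mulrCA ler_wpM2l ?ler0n //.
by rewrite ler_pdivrMr ?exprn_gt0.
Qed.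

(** A vertex with nonempty link is an apex, so no tilt depends on the colour of a vertex that is
    itself tilted. *)
Lemma link_indep v S w : S \in link v -> link w != set0 -> w \notin S.
Proof.
rewrite inE => /andP[SS1 _] /set0Pn[S']; rewrite inE => /andP[S'S /eqP <-].
exact: apex_notin.
Qed.

Lemma tilt_indep v w : link w != set0 -> indep_of w (tilt v).
Proof.
move=> Lw f c; rewrite /tilt; congr (_ * _); apply: eq_bigr => S SL.
by rewrite (mon_indep _ (link_indep SL Lw)).
Qed.

Lemma cotilt_indep v w : link w != set0 -> indep_of w (cotilt v).
Proof. by move=> Lw f c; rewrite /cotilt (tilt_indep v Lw). Qed.

Lemma tilt0 v f : link v = set0 -> tilt v f = 0.
Proof. by move=> L0; rewrite /tilt L0 big_set0 mulr0. Qed.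

Lemma cotilt0 v f : link v = set0 -> cotilt v f = 0.
Proof. by move=> L0; rewrite /cotilt tilt0 // if_same. Qed.

Definition tilted f : R := \prod_v (1 + t * cotilt v f * X v f).

Lemma tilted_ge0 f : 0 <= tilted f.
Proof.
apply: prodr_ge0 => v _; rewrite -lerBlDl sub0r.
have : `|t * cotilt v f * X v f| <= 1.
  rewrite normrM mulr_ile1 ?normr_ge0 ?chi_le1 //.
  by rewrite /cotilt; case: ifP => //; rewrite mulr0 normr0 ler01.
by rewrite ler_norml => /andP[].
Qed.

Section Expansion.
Variables (e : {set T}) (cut : {ffun T -> C} -> R).
Hypothesis cut01 : forall f, 0 <= cut f <= 1.
Hypothesis cut_indep : forall v, v \notin e -> indep_of v cut.

Let norm_cut f : `|cut f| <= 1.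
Proof. by have /andP[? ?] := cut01 f; rewrite ger0_norm. Qed.

(** Expand the product over sets [Q] of tilted vertices. If [v] in [Q] lies outside [e], either its
    tilt is zero or its colour enters only through [X v f], and the term vanishes. *)
Lemma avg_cut_tilted : avg (fun f => cut f * tilted f) =
  \sum_(Q : {set T} | Q \subset e) t ^+ #|Q| *
    avg (fun f => cut f * \prod_(v in Q) (cotilt v f * X v f)).
Proof.
transitivity (avg (fun f => \sum_(Q : {set T}) t ^+ #|Q| *
    (cut f * \prod_(v in Q) (cotilt v f * X v f)))).
  apply: eq_avg => f; rewrite /tilted.
  under eq_bigr do rewrite addrC; rewrite bigA_distr mulr_sumr.
  apply: eq_bigr => Q _; rewrite mulrCA; congr (_ * _).
  by rewrite -big_mkcond /= -prodr_const -big_split /=; apply: eq_bigr => v _;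
      rewrite mulrA.
rewrite avg_sum [RHS]big_mkcond; apply: eq_bigr => Q _; rewrite avgZ.
case: ifP => // /negbT/subsetPn[v vQ ve]; apply/eqP; rewrite mulf_eq0; apply/orP; right.
apply/eqP; have [L0|L0] := eqVneq (link v) set0.
  rewrite -[RHS](avg_cst T C_gt0 0); apply: eq_avg => f.
  by rewrite (bigD1 v) //= cotilt0 // !mul0r mulr0.
pose rest f := cut f * (cotilt v f * \prod_(w in Q | w != v) (cotilt w f * X w f)).
rewrite -(avg_indep0 C_gt0 (v := v) (phi := chi v) (G := rest)) ?(chi_sum0 chi_odd) //.
  by apply: eq_avg => f; rewrite /rest (bigD1 v) //=; ring.
move=> f c; rewrite /rest cut_indep // (cotilt_indep v L0); congr (_ * (_ * _)).
apply: eq_bigr => w /andP[_ wv]; rewrite (cotilt_indep w L0); congr (_ * _).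
by rewrite ffunE (negPf wv).
Qed.

(** The products differ only where some [|t * tilt v f|] exceeds 1. There the trivial bound
    [(C0 A)^k] may be multiplied by [(t * tilt v f)^(2q)], whose average [tilt_moment] controls. *)
Lemma cotilt_error Q : (#|Q| <= k)%N ->
  `|avg (fun f => cut f * \prod_(v in Q) (tilt v f * X v f)) -
    avg (fun f => cut f * \prod_(v in Q) (cotilt v f * X v f))| <=
  (C0 * A) ^+ k * (k%:R * (t ^+ q.*2 * (((q.*2 ^ 2) ^ s)%:R * C0) ^+ q)).
Proof.
move=> Qk; rewrite -avgB; apply: le_trans (ler_norm_avg _) _.
have CA_ge1 : 1 <= C0 * A by rewrite mulr_ege1.
apply: (le_trans (y := avg (fun f =>
    (C0 * A) ^+ k * \sum_(v in Q) (t ^+ q.*2 * tilt v f ^+ q.*2)))).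
  apply: ler_avg => f; rewrite -mulrBr normrM.
  apply: (le_trans (y := 1 * `|\prod_(v in Q) (tilt v f * X v f) - \prod_(v in Q)
      (cotilt v f * X v f)|)).
    by rewrite ler_wpM2r.
  have split_X (F : T -> {ffun T -> C} -> R) :
      \prod_(v in Q) (F v f * X v f) = \prod_(v in Q) X v f * \prod_(v in Q) F v f.
    by rewrite big_split mulrC.
  rewrite mul1r !split_X -mulrBr normrM.
  apply: (le_trans (y := 1 * `|\prod_(v in Q) tilt v f - \prod_(v in Q) cotilt v f|)).
    by rewrite ler_wpM2r // normr_prod prodr_ile1 // => v _; rewrite normr_ge0 chi_le1.
  rewrite mul1r.
  have even_ge0 v : 0 <= t ^+ q.*2 * tilt v f ^+ q.*2.
    by rewrite -exprMn -mul2n exprM exprn_ge0 ?sqr_ge0.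
  case: (pickP (fun v => (v \in Q) && ~~ (`|t * tilt v f| <= 1))) =>
      [v /andP[vQ big]|none].
    have -> : \prod_(v in Q) cotilt v f = 0.
      by rewrite (bigD1 v) //= /cotilt (negPf big) mul0r.
    rewrite subr0 normr_prod; apply: (le_trans (y := (C0 * A) ^+ k * 1)).
      rewrite mulr1; apply: (le_trans (y := \prod_(w in Q) (C0 * A))).
        by apply: ler_prod => w _; rewrite normr_ge0 tilt_le.
      by rewrite prodr_const ler_weXn2l.
    rewrite ler_wpM2l ?exprn_ge0 ?(le_trans ler01 CA_ge1) //.
    rewrite (bigD1 v) //= ler_wpDr ?sumr_ge0 //.
    rewrite -exprMn -mul2n exprM -real_normK ?num_real // -exprM exprn_ege1 //.
    by rewrite ltW // ltNge.
  rewrite [Y in _ - Y](eq_bigr (fun v => tilt v f)) => [|v vQ]; last first.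
    by rewrite /cotilt; move: (none v); rewrite vQ /= => /negbT; rewrite negbK => ->.
  by rewrite subrr normr0 mulr_ge0 ?exprn_ge0 ?(le_trans ler01 CA_ge1) // sumr_ge0.
rewrite avgZ avg_sum ler_wpM2l ?exprn_ge0 ?(le_trans ler01 CA_ge1) //.
apply: (le_trans (y := \sum_(v in Q) (t ^+ q.*2 * (((q.*2 ^ 2) ^ s)%:R * C0) ^+ q))).
  by apply: ler_sum => v _; rewrite avgZ ler_wpM2l ?tilt_moment // exprn_ge0 //;
      case/andP: t01.
rewrite sumr_const -[leLHS]mulr_natl ler_wpM2r ?ler_nat //.
have [t0 _] := andP t01.
by rewrite mulr_ge0 ?exprn_ge0 // mulr_ge0 ?ler0n.
Qed.

(** Otherwise some vertex outside [e] is covered exactly once; its variable occurs to the first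
    power, and nothing else depends on its colour because [Q] lies inside [e]. *)
Lemma avg_cut_fam Q (g : {ffun T -> {set T}}) : Q \subset e ->
  (forall v, v \in Q -> g v \in link v) -> (forall v, v \notin Q -> g v = set0) ->
  g \notin fam e Q ->
  avg (fun f => cut f * \prod_(v in Q) (mon (g v) f * X v f)) = 0.
Proof.
move=> Qe gL g0 gF; have [x xe gx] : exists2 x, x \notin e & #|[set v | x \in g v]| ==
    1%N.
  case: (pickP (fun x => (x \notin e) && (#|[set v | x \in g v]| == 1%N))) =>
      [x /andP[? ?]|none].
    by exists x.
  case/negP: gF; apply/famP; split=> // x xe; apply/eqP.
  by move: (none x); rewrite xe /= => ->.
have [v gv] := cards1P gx.
have xgv : x \in g v by have := set11 v; rewrite -gv inE.
have vQ : v \in Q by apply/negPn/negP => /g0 e0; rewrite e0 inE in xgv.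
have xother w : w != v -> x \notin g w.
  move=> wv; apply/negP => xw.
  have : w \in [set v | x \in g v] by rewrite inE.
  by rewrite gv inE (negPf wv).
pose rest f := cut f * (mon (g v :\ x) f * X v f * \prod_(w in Q | w != v) (mon (g w) f
    * X w f)).
rewrite -(avg_indep0 C_gt0 (v := x) (phi := chi x) (G := rest)) ?(chi_sum0 chi_odd) //.
  apply: eq_avg => f; rewrite /rest (bigD1 v) //= -{1}(setD1K xgv) monU1 ?setD11 //.
  ring.
have Xx w f c : w \in Q -> X w (recolour f x c) = X w f.
  move=> wQ; rewrite ffunE; case: eqP => // wx.
  by rewrite -wx (subsetP Qe) in xe.
move=> f c; rewrite /rest cut_indep // mon_indep ?setD11 // Xx //.
congr (_ * (_ * _ * _)); apply: eq_bigr => w /andP[wQ wv].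
by rewrite mon_indep ?xother // Xx.
Qed.

Lemma avg_cut_tilt Q : Q \subset e ->
  `|avg (fun f => cut f * \prod_(v in Q) (tilt v f * X v f))| <=
  #|fam e Q|%:R / A ^+ #|Q|.
Proof.
move=> Qe.
have -> : avg (fun f => cut f * \prod_(v in Q) (tilt v f * X v f)) =
   \sum_(g in pfamily set0 (mem Q) (fun v => mem (link v)))
    (sg / A) ^+ #|Q| * avg (fun f => cut f * \prod_(v in Q) (mon (g v) f * X v f)).
  under [RHS]eq_bigr do rewrite -avgZ; rewrite -avg_sum; apply: eq_avg => f.
  under [RHS]eq_bigr do rewrite mulrCA; rewrite -mulr_sumr; congr (_ * _).
  under eq_bigr do rewrite /tilt -mulrA mulr_suml.
  rewrite big_split /= prodr_const -mulr_sumr; congr (_ * _).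
  exact: (big_distr_big_dep (set0 : {set T})).
have normc : `|sg / A| = A^-1 by rewrite normrM sg1 mul1r normfV gtr0_norm.
apply: le_trans (ler_norm_sum _ _ _) _.
apply: (le_trans (y := \sum_(g in fam e Q) A ^- #|Q|)).
  rewrite [leRHS]big_mkcond [leLHS]big_mkcond; apply: ler_sum => g _ /=.
  have pos : 0 <= A ^- #|Q| by rewrite invr_ge0 exprn_ge0 // ltW.
  case: ifP => gP; last by case: ifP.
  have gL v : v \in Q -> g v \in link v by move/pfamilyP: gP => [_ H] /H.
  have g0 v : v \notin Q -> g v = set0.
    by move/pfamilyP: gP => [/subsetP H _] vQ; apply/eqP; apply: contraNT vQ => /H.
  rewrite normrM normrX normc exprVn; case: ifP => [_|/negbT gF].
    rewrite ler_piMr // (le_trans (ler_norm_avg _)) // -[leRHS](avg_cst T C_gt0 1).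
    apply: ler_avg => f; rewrite normrM mulr_ile1 // normr_prod prodr_ile1 // => v _.
    by rewrite normr_ge0 normrM mulr_ile1 ?normr_ge0 ?chi_le1 // norm_mon_le1.
  by rewrite avg_cut_fam // normr0 mulr0.
by rewrite sumr_const mulr_natl.
Qed.

End Expansion.
End Tilting.

Lemma eq_ler (R : numDomainType) (x y : R) : x = y -> x <= y.
Proof. by move=> ->. Qed.

Lemma sum_singletons (R : zmodType) (T : finType) (e : {set T}) (F : {set T} -> R) :
  \sum_(Q : {set T} | (Q \subset e) && (#|Q| == 1)%N) F Q = \sum_(v in e) F [set v].
Proof.
rewrite -(big_imset _ (h := set1)) /=; last by move=> v w _ _ /set1_inj.
apply: eq_bigl => Q; apply/andP/imsetP => [[Qe /cards1P[v e1]]|[v ve ->]].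
  by exists v => //; rewrite e1 sub1set in Qe.
by rewrite sub1set cards1.
Qed.

(* With this order, [t^(2q)] beats the trivial bound [A^k] on a product of tilts. *)
Definition moment_order (k L : nat) := (L * k.+1).+1.

Definition tail_const (R : realFieldType) (k s L : nat) (C0 : R) : R :=
  k%:R * C0 ^+ k *
    ((((moment_order k L).*2 ^ 2) ^ s)%:R * C0) ^+ moment_order k L.

(** [kappa] is the budget for [K = e], with [k] vertices, and at most [k] sets of size [s]. *)
Definition count_const (R : realFieldType) (k s : nat) (C0 : R) : R :=
  let kappa := (k + s * k)%N in
  (1 + C0 ^+ 2 * (kappa * 2 ^ kappa)%:R) * fam_const kappa C0 ^+ kappa.

(** Each of the [2 ^ k] subsets of an edge is charged once for counting and once for truncation. *)
Definition loss_const (R : realFieldType) (k s L : nat) (C0 : R) : R :=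
  (2 ^ k)%:R * (count_const k s C0 + tail_const k s L C0).

Lemma fam_const_ge1 (R : realFieldType) kappa (C0 : R) : 1 <= C0 -> 1 <=
    fam_const kappa C0.
Proof.
move=> C1; rewrite /fam_const ler_wpDl // mulr_ge0 ?addr_ge0 ?ler0n //.
exact: le_trans ler01 C1.
Qed.

(** * Surplus from a family of linked sets *)

Section SurplusOfLinks.
Variables (R : realFieldType) (T : finType) (C : finType).
Hypothesis C_gt0 : (0 < #|C|)%N.
Variable chi : T -> C -> R.
Hypothesis chi_odd : forall v i, odd i -> \sum_c chi v c ^+ i = 0.
Hypothesis chi_le1 : forall v c, `|chi v c| <= 1.
Variables (SS : {set {set T}}) (apex : {set T} -> T).
Variables (A B C0 tau kap D : R) (s j0 k L : nat).
Hypotheses (B_ge1 : 1 <= B) (C0_ge1 : 1 <= C0) (s_gt0 : (0 < s)%N).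
Hypothesis A_pow : A = B ^+ L.
Hypothesis L_j0 : (L < j0.*2)%N.
Hypothesis j0_gt0 : (0 < j0)%N.
Hypothesis card_SS : forall S, S \in SS -> #|S| = s.
Hypothesis apex_notin : forall S S', S \in SS -> S' \in SS -> apex S \notin S'.
Hypothesis link1 : forall v, #|link SS apex v|%:R <= C0 * A ^+ 2.
Hypothesis link2 : forall v x, #|[set S in link SS apex v | x \in S]|%:R <= C0 * A.
Hypothesis link3 : forall v (Q : {set T}), (s <= j0 * #|Q|)%N ->
  #|[set S in link SS apex v | Q \subset S]|%:R <= C0 * B.
Hypothesis tau01 : 0 <= tau <= 1.
Variables (E : {set {set T}}) (cut : {set T} -> {ffun T -> C} -> R).
Hypothesis card_E : forall e, e \in E -> #|e| = k.
Hypothesis E_le : #|E|%:R <= A ^+ 3.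
Hypothesis cut01 : forall e f, 0 <= cut e f <= 1.
Hypothesis cut_indep : forall (e : {set T}) v, v \notin e -> indep_of v (cut e).
Hypothesis kap_neq0 : kap != 0.
Hypothesis cut_coef : forall S (e : {set T}), S \in SS -> e \in E -> apex S |: S
    \subset e ->
  avg (fun f => cut e f * mon chi (apex S |: S) f) = kap.
Hypothesis cut_le : forall f,
  \sum_(e in E) cut e f <= \sum_(e in E) avg (cut e) + D.
Implicit Types (f : {ffun T -> C}) (S Q e : {set T}) (v w x : T).

Let q := moment_order k L.
Let sg : R := Num.sg kap.
Let t : R := tau * B ^- 2.
Local Notation X v f := (chi v (f v)).
Local Notation link := (link SS apex).
Local Notation mon := (mon chi).
Local Notation fam := (fam SS apex).
Local Notation tilt := (tilt chi SS apex A sg).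
Local Notation cotilt := (cotilt chi SS apex A t sg).
Local Notation tilted := (tilted chi SS apex A t sg).

Let B_gt0 : 0 < B. Proof. exact: lt_le_trans ltr01 B_ge1. Qed.
Let A_ge1 : 1 <= A. Proof. by rewrite A_pow exprn_ege1. Qed.
Let A_gt0 : 0 < A. Proof. exact: lt_le_trans ltr01 A_ge1. Qed.
Let C0_ge0 : 0 <= C0. Proof. exact: le_trans ler01 C0_ge1. Qed.
Let q_gt0 : (0 < q)%N. Proof. by []. Qed.
Let sg1 : `|sg| = 1. Proof. by rewrite normr_sg kap_neq0. Qed.
Let tau_ge0 : 0 <= tau. Proof. by case/andP: tau01. Qed.
Let tau_le1 : tau <= 1. Proof. by case/andP: tau01. Qed.
Let B2_le1 : B ^- 2 <= 1. Proof. by rewrite invf_le1 ?exprn_gt0 // exprn_ege1. Qed.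
Let B2_ge0 : 0 <= B ^- 2. Proof. by rewrite invr_ge0 exprn_ge0 // ltW. Qed.
Let t01 : 0 <= t <= 1.
Proof. by rewrite /t mulr_ge0 //= mulr_ile1. Qed.
Let t_ge0 : 0 <= t. Proof. by case/andP: t01. Qed.
Let t_le1 : t <= 1. Proof. by case/andP: t01. Qed.

Let count_ge0 : 0 <= count_const k s C0.
Proof.
rewrite /count_const mulr_ge0 ?addr_ge0 ?mulr_ge0 ?ler0n ?exprn_ge0 //.
exact: le_trans ler01 (fam_const_ge1 _ C0_ge1).
Qed.

Let tail_ge0 : 0 <= tail_const k s L C0.
Proof.
by rewrite /tail_const mulr_ge0 ?mulr_ge0 ?exprn_ge0 ?mulr_ge0 ?ler0n.
Qed.

Lemma t_expn_le j : (1 < j)%N -> t ^+ j <= t * tau * B ^- 2.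
Proof.
case: j => [|[|j]] // _; rewrite 2!exprSr -mulrA [t * tau * _](_ : _ = 1 * (t * t)).
  by rewrite ler_wpM2r ?mulr_ge0 // exprn_ile1.
by rewrite /t; ring.
Qed.

(** Expanding against the constant cut 1 and the empty edge leaves only the empty term. *)
Lemma avg_tilted1 : avg tilted = 1.
Proof.
have c01 (f : {ffun T -> C}) : 0 <= (1 : R) <= 1 by rewrite ler01 lexx.
have := avg_cut_tilted C_gt0 chi_odd A t sg apex_notin (e := set0) (cut := fun=> 1).
under eq_avg => f do rewrite mul1r.
rewrite (eq_bigl (pred1 set0)) => [|Q]; last by rewrite subset0.
rewrite big_pred1_eq cards0 expr0 mul1r => -> //.
under eq_avg => f do rewrite big_set0 mul1r.
exact: avg_cst.
Qed.

(** Up to [j0] sets, counting gives [B / A], and the powers of [t] beyond the first give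
    [tau / B^2]. For more sets counting gives only a constant, but [t^j0 <= tau / B^(2 j0)], which
    [L < 2 j0] makes at most [tau / (A B)]. *)
Lemma tilt_term_le e Q : e \in E -> Q \subset e -> (1 < #|Q|)%N ->
  t ^+ #|Q| * `|avg (fun f => cut e f * \prod_(v in Q) (tilt v f * X v f))| <=
  t * tau * count_const k s C0 / (A * B).
Proof.
move=> eE Qe Q1.
have Qk : (#|Q| <= k)%N by rewrite -(card_E eE) subset_leq_card.
have bound : (#|e| + s * #|Q| <= k + s * k)%N by rewrite (card_E eE) leq_add2l
    leq_mul2l Qk orbT.
have le_fam : `|avg (fun f => cut e f * \prod_(v in Q) (tilt v f * X v f))| <=
    #|fam e Q|%:R / A ^+ #|Q|.
  exact: (avg_cut_tilt C_gt0 chi_odd chi_le1 SS apex A_ge1 sg1 (cut01 e) (@cut_indep e)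
      Qe).
set kappa := (k + s * k)%N in bound.
have G1 := fam_const_ge1 kappa C0_ge1.
have AQ : 0 < A ^+ #|Q| by rewrite exprn_gt0.
apply: (le_trans (ler_wpM2l (exprn_ge0 _ t_ge0) le_fam)).
have [Qj|jQ] := leqP #|Q| j0.
  have := card_fam_flat A_ge1 B_ge1 C0_ge1 s_gt0 card_SS link1 link2 link3 (K := e) (J
      := Q).
  move=> /(_ kappa); rewrite Qj (ltnW Q1) => /(_ isT bound) flat.
  apply: (le_trans (y := t ^+ #|Q| * (count_const k s C0 * B / A))).
    rewrite ler_wpM2l ?exprn_ge0 // ler_pdivrMr // -(ler_pM2l A_gt0) (le_trans flat) //.
    rewrite /count_const -/kappa.
    by rewrite [leRHS](_ : _ = (1 + C0 ^+ 2 * (kappa * 2 ^ kappa)%:R) * fam_const kappa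
        C0 ^+ kappa * B * A ^+ #|Q|) //; field; rewrite gt_eqF.
  apply: (le_trans (ler_wpM2r _ (t_expn_le Q1))).
    by rewrite mulr_ge0 ?invr_ge0 ?(ltW A_gt0) // mulr_ge0 ?(ltW B_gt0).
  by apply: eq_ler; field; rewrite !gt_eqF.
have tot := card_fam_le A_ge1 C0_ge1 s_gt0 card_SS link1 link2 bound.
apply: (le_trans (y := t ^+ #|Q| * count_const k s C0)).
  rewrite ler_wpM2l ?exprn_ge0 // ler_pdivrMr // (le_trans tot) // ler_wpM2r ?(ltW AQ)
      //.
  rewrite /count_const -/kappa (le_trans (y := 1 * fam_const kappa C0 ^+ kappa)) //.
    rewrite mul1r ler_weXn2l // (leq_trans Qk) // leq_addr //.
  by rewrite ler_wpM2r ?exprn_ge0 ?(le_trans ler01 G1) // lerDl mulr_ge0 ?exprn_ge0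
      ?ler0n.
rewrite [leRHS]mulrAC ler_wpM2r //.
apply: (le_trans (y := t * t ^+ j0)).
  by rewrite -exprS ler_wiXn2l.
rewrite -[leRHS]mulrA ler_wpM2l //.
have -> : t ^+ j0 = tau ^+ j0 * (B ^+ j0.*2)^-1.
  by rewrite /t exprMn exprVn -exprM mul2n.
apply: ler_pM; rewrite ?exprn_ge0 ?invr_ge0 ?exprn_ge0 ?(ltW B_gt0) //.
  by rewrite -[leRHS]expr1 ler_wiXn2l.
rewrite lef_pV2 ?posrE ?mulr_gt0 ?exprn_gt0 // A_pow -exprSr ler_weXn2l //.
Qed.

Lemma tail_le : (C0 * A) ^+ k * (k%:R * (t ^+ q.*2 * (((q.*2 ^ 2) ^ s)%:R * C0) ^+ q))
    <=
  tau * tail_const k s L C0 / (A * B).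
Proof.
have -> : (C0 * A) ^+ k * (k%:R * (t ^+ q.*2 * (((q.*2 ^ 2) ^ s)%:R * C0) ^+ q)) =
  tail_const k s L C0 * (A ^+ k * t ^+ q.*2) by rewrite /tail_const -/q exprMn; ring.
rewrite [tau * _]mulrC -[leRHS]mulrA ler_wpM2l //.
have -> : t ^+ q.*2 = tau ^+ q.*2 * (B ^+ (2 * q.*2))^-1 by rewrite /t exprMn exprVn
    -exprM.
rewrite mulrCA; apply: ler_pM; rewrite ?exprn_ge0 ?mulr_ge0 ?invr_ge0 ?exprn_ge0 ?(ltW
    B_gt0) ?(ltW A_gt0) //.
  by rewrite -[leRHS]expr1 ler_wiXn2l.
rewrite ler_pdivrMr ?exprn_gt0 // ler_pdivlMl ?mulr_gt0 // A_pow -exprM -exprSr -exprD.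
rewrite ler_weXn2l // /q /moment_order; clear; nia.
Qed.

Lemma edge_tilted_ge e : e \in E ->
  avg (cut e) + t * \sum_(v in e) avg (fun f => cut e f * (tilt v f * X v f))
    - t * tau * loss_const k s L C0 / (A * B) <=
  avg (fun f => cut e f * tilted f).
Proof.
move=> eE; rewrite (avg_cut_tilted C_gt0 chi_odd A t sg apex_notin (cut_indep (e :=
    e))).
pose c0 := count_const k s C0; pose c1 := tail_const k s L C0.
pose bnd : R := t * tau * (c0 + c1) / (A * B).
(* [main] keeps the empty set and the singletons, the latter untruncated. Every [Q] is charged
   [bnd], which covers truncation and all terms of degree at least 2. *)
pose main (Q : {set T}) : R := if Q == set0 then avg (cut e) else
  if #|Q| == 1%N then t * avg (fun f =>
      cut e f * \prod_(v in Q) (tilt v f * X v f)) else 0.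
have tt0 : 0 <= t * tau by rewrite mulr_ge0.
have AB0 : 0 <= (A * B)^-1 by rewrite invr_ge0 mulr_ge0 ?(ltW A_gt0) ?(ltW B_gt0).
apply: (le_trans (y := \sum_(Q : {set T} | Q \subset e) (main Q - bnd))).
  rewrite sumrB; apply: lerB.
    rewrite (bigD1 set0) ?sub0set //= {1}/main eqxx lerD //.
    rewrite (bigID (fun Q : {set T} => #|Q| == 1%N)) /= [Y in _ + Y]big1 =>
        [|Q /andP[/andP[_ Q0] Q1]]; last first.
      by rewrite /main (negPf Q0) (negPf Q1).
    rewrite addr0 mulr_sumr.
    rewrite (eq_bigl (fun Q : {set T} => (Q \subset e) && (#|Q| == 1%N))) => [|Q].
      rewrite sum_singletons; apply: ler_sum => v ve.
      rewrite /main cards1 eqxx -cards_eq0 cards1 /=.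
      by under [in leRHS]eq_avg => f do rewrite big_set1.
    by rewrite -andbA; congr (_ && _); case: eqP => //= ->; rewrite cards0.
  have card_sub : #|[pred Q : {set T} | Q \subset e]| = (2 ^ k)%N.
    by rewrite -(card_E eE) -card_powerset; apply: eq_card => Q; rewrite powersetE.
  rewrite sumr_const card_sub -[leLHS]mulr_natl.
  by rewrite /bnd /loss_const -/c0 -/c1; apply: eq_ler; ring.
apply: ler_sum => Q Qe.
have Qk : (#|Q| <= k)%N by rewrite -(card_E eE) subset_leq_card.
have err := cotilt_error C_gt0 chi_odd chi_le1 A_ge1 C0_ge1 card_SS link1 sg1 t01 q_gt0
    (cut01 e) Qk.
have {err} := le_trans err tail_le.
set ct := avg (fun f => cut e f * \prod_(v in Q) (cotilt v f * X v f)).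
pose tl := avg (fun f => cut e f * \prod_(v in Q) (tilt v f * X v f)).
rewrite -/tl -/c1 => err.
have tQ0 : 0 <= t ^+ #|Q| by rewrite exprn_ge0.
have part (x : R) : 0 <= x -> 0 <= t * tau * x / (A * B) by move=> ?;
    rewrite mulr_ge0 // mulr_ge0.
have p0 := part _ count_ge0; have p1 := part _ tail_ge0.
have bndE : bnd = t * tau * c0 / (A * B) + t * tau * c1 / (A * B) by rewrite /bnd; ring.
rewrite /main; have [Q0|Q0] := eqVneq Q set0.
  rewrite Q0 cards0 expr0 mul1r lerBlDr ler_wpDr ?bndE ?addr_ge0 //.
  by rewrite /ct Q0; under [leRHS]eq_avg => f do rewrite big_set0 mulr1.
have errt : t ^+ #|Q| * `|tl - ct| <= t * tau * c1 / (A * B).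
  rewrite -[t * tau * _]mulrA -mulrA; apply: ler_pM => //.
  rewrite -[leRHS]expr1 ler_wiXn2l // lt0n cards_eq0 //.
case: ifP => [/eqP Q1|/negbT Q1].
  rewrite Q1 expr1 in errt *; rewrite -/tl lerBlDr -lerBlDl -mulrBr.
  apply: (le_trans (ler_norm _)); rewrite normrM (ger0_norm t_ge0) (le_trans errt) //.
  by rewrite bndE lerDr.
have Q2 : (1 < #|Q|)%N by move: Q1; rewrite -cards_eq0 in Q0; case: #|Q| Q0 => [|[]].
have tlt := tilt_term_le eE Qe Q2; rewrite -/tl -/c0 in tlt.
rewrite sub0r lerNl -mulrN bndE.
have -> : - ct = - tl + (tl - ct) by ring.
rewrite mulrDr lerD //.
  by apply: le_trans tlt; rewrite ler_wpM2l // (le_trans (ler_norm _)) // normrN.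
by apply: le_trans errt; rewrite ler_wpM2l // ler_norm.
Qed.

(** [sg] turns each correlation into [|kap|]; a set with a vertex outside [e] contributes nothing,
    since the variable of that vertex averages out. *)
Lemma linear_term :
  \sum_(e in E) \sum_(v in e) avg (fun f => cut e f * (tilt v f * X v f)) =
  `|kap| / A * (\sum_(S in SS) #|[set e in E | apex S |: S \subset e]|)%:R.
Proof.
have term e v : e \in E -> v \in e ->
    avg (fun f => cut e f * (tilt v f * X v f)) =
    \sum_(S in link v | S \subset e) `|kap| / A.
  move=> eE ve.
  have -> : avg (fun f => cut e f * (tilt v f * X v f)) =
     \sum_(S in link v) sg / A * avg (fun f => cut e f * mon (v |: S) f).
    under [RHS]eq_bigr do rewrite -avgZ; rewrite -avg_sum; apply: eq_avg => f.
    rewrite -mulr_sumr /tilt [LHS](_ : _ = sg / A * ((\sum_(S in link v) mon S f) *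
        (cut e f * X v f))); last by ring.
    congr (_ * _); rewrite mulr_suml; apply: eq_bigr => S.
    by rewrite inE => /andP[SSS /eqP <-]; rewrite monU1 ?apex_notin //; ring.
  rewrite big_mkcondr /=; apply: eq_bigr => S.
  rewrite inE => /andP[SSS /eqP av]; case: ifP => Se.
    rewrite -av cut_coef // ?av ?subUset ?sub1set ?ve //.
    by rewrite mulrAC -[sg * kap]/(Num.sg kap * kap) -normrEsg.
  have /subsetPn[x xS xe] : ~~ (S \subset e) by rewrite Se.
  apply/eqP; rewrite mulf_eq0; apply/orP; right; apply/eqP.
  have vS : v \notin S by rewrite -av apex_notin.
  have xvS : x \in v |: S by rewrite inE xS orbT.
  rewrite -(avg_indep0 C_gt0 (v := x) (phi := chi x) (G := fun f =>
      cut e f * mon ((v |: S) :\ x) f))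
    ?(chi_sum0 chi_odd) //; last by move=> f c; rewrite cut_indep // mon_indep ?setD11.
  by apply: eq_avg => f; rewrite mulrCA -monU1 ?setD11 // setD1K.
transitivity (\sum_(e in E) \sum_(S in SS | apex S |: S \subset e) `|kap| / A).
  apply: eq_bigr => e eE; rewrite (eq_bigr _ (fun v ve => term e v eE ve)).
  rewrite (exchange_big_dep (fun S => (S \in SS) && (S \subset e))) /=; last first.
    by move=> v S _ /andP[]; rewrite inE => /andP[-> _] ->.
  rewrite [LHS]big_mkcond [RHS]big_mkcond; apply: eq_bigr => S _.
  rewrite subUset sub1set; case: (boolP (S \in SS)) => //= SSS.
  case: (boolP (S \subset e)) => Se; rewrite ?andbF // andbT.
  rewrite (eq_bigl (fun v => (v == apex S) && (apex S \in e))) => [|v].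
    case: ifP => ae; last by rewrite big_pred0 // => v; rewrite andbF.
    by rewrite (eq_bigl (pred1 (apex S))) ?big_pred1_eq // => v; rewrite andbT.
  by rewrite inE SSS eq_sym andbT; case: eqP => [->|]; rewrite ?andbT ?andbF.
rewrite (exchange_big_dep (mem SS)) /=; last by move=> e S _ /andP[].
rewrite natr_sum mulr_sumr; apply: eq_bigr => S SSS.
rewrite sumr_const -[LHS]mulr_natr; congr (_ * _%:R).
by apply: eq_card => e; rewrite !inE SSS.
Qed.

(** [tilted] is nonnegative with mean 1, so the cut averaged against it exceeds the uniform mean by
    at most [D]. The loss per edge, of order [1 / (A B)], is summed over at most [A^3] edges. *)
Theorem surplus_of_links :
  tau * B ^- 2 * (`|kap| / A * (\sum_(S in SS) #|[set e in E | apex S |: S \subset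
      e]|)%:R)
  - tau * B ^- 2 * tau * loss_const k s L C0 * (A ^+ 2 / B) <= D.
Proof.
rewrite -/t.
have upper : avg (fun f => (\sum_(e in E) cut e f) * tilted f) <=
    \sum_(e in E) avg (cut e) + D.
  rewrite -[leRHS]mulr1 -avg_tilted1 -avgZ; apply: ler_avg => f.
  by rewrite ler_wpM2r // (tilted_ge0 chi_le1).
rewrite -(lerD2l (\sum_(e in E) avg (cut e))); apply: le_trans upper.
under [leRHS]eq_avg => f do rewrite mulr_suml.
rewrite avg_sum; apply: le_trans (ler_sum _ edge_tilted_ge).
rewrite -linear_term mulr_sumr sumrB big_split /= addrA lerD2l lerN2.
rewrite sumr_const -[leLHS]mulr_natr.
apply: (le_trans (ler_wpM2l _ E_le)).
  have loss_ge0 : 0 <= loss_const k s L C0 by rewrite /loss_const mulr_ge0 ?ler0n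
      ?addr_ge0.
  have AB_ge0 : 0 <= (A * B)^-1 by rewrite invr_ge0 mulr_ge0 ?(ltW A_gt0) ?(ltW B_gt0).
  by rewrite mulr_ge0 // mulr_ge0 // mulr_ge0.
by apply: eq_ler; field; rewrite !gt_eqF.
Qed.

End SurplusOfLinks.

(** * Level coefficients of the cut function *)

Definition is_hit (T : finType) (r : nat) (e : {set T}) (f : {ffun T -> 'I_r}) : bool :=
  [forall c, [exists v, (v \in e) && (f v == c)]].

Definition fibres (T : finType) (r : nat) (f : {ffun T -> 'I_r}) : {set {set T}} :=
  [set f @^-1: [set c] | c : 'I_r].

Lemma fibres_partition (T : finType) (r : nat) (f : {ffun T -> 'I_r}) :
  (forall c, exists v, f v = c) -> partition (fibres f) [set: T] /\ #|fibres f| = r.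
Proof.
move=> ex; have FE c v : (v \in f @^-1: [set c]) = (f v == c) by rewrite !inE.
split; last first.
  rewrite /fibres card_imset ?card_ord // => c d e; have [v fv] := ex c.
  by have := FE c v; rewrite e FE fv eqxx => /eqP.
apply/and3P; split.
- rewrite eqEsubset subsetT /=; apply/subsetP => v _; apply/bigcupP.
  by exists (f @^-1: [set f v]); rewrite ?FE ?eqxx // imset_f.
- apply/trivIsetP => _ _ /imsetP[c _ ->] /imsetP[d _ ->] ne.
  rewrite -setI_eq0; apply/eqP/setP => v; rewrite in_setI !FE in_set0.
  by apply/negP => /andP[/eqP vc /eqP vd]; case/eqP: ne; rewrite -vc -vd.
- apply/imsetP => -[c _ e]; have [v fv] := ex c.
  by have := FE c v; rewrite -e inE fv eqxx.
Qed.

(** A surjection is an injective labelling of its fibres by the colours; grouping by the partition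
    into fibres gives [r!] labellings each. *)
Lemma card_surjections (k r : nat) :
  #|[set f : {ffun 'I_k -> 'I_r} | is_hit setT f]| = (stirling2 k r * r`!)%N.
Proof.
pose F (f : {ffun 'I_k -> 'I_r}) : {ffun 'I_r -> {set 'I_k}} := [ffun c =>
    f @^-1: [set c]].
have FE f c i : (i \in F f c) = (f i == c) by rewrite ffunE !inE.
have F_inj : injective F.
  move=> f g e; apply/ffunP => i; have /esym := FE g (f i) i.
  by rewrite -e FE eqxx => /eqP.
pose im (h : {ffun 'I_r -> {set 'I_k}}) := [set h c | c : 'I_r].
pose parts := [set P : {set {set 'I_k}} | partition P [set: 'I_k] & #|P| == r].
pose H := [set h : {ffun 'I_r -> {set 'I_k}} | injectiveb h && (im h \in parts)].
rewrite -(card_imset _ F_inj) (_ : F @: _ = H).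
  rewrite -sum1_card (partition_big im (mem parts)) /=; last by move=> h;
      rewrite inE => /andP[].
  rewrite (eq_bigr (fun=> r`!)) ?sum_nat_const // => P; rewrite inE =>
      /andP[Ppart /eqP cP].
  have <- : (#|P| ^_ #|'I_r| = r`!)%N by rewrite cP card_ord ffactnn.
  rewrite sum1dep_card -card_inj_ffuns_on.
  apply: eq_card => h; rewrite !inE; apply/andP/andP =>
      [[/andP[hi _] /eqP <-]|[/forallP hP hi]].
    by split=> //; apply/forallP => c; apply: imset_f.
  have imP : im h = P.
    apply/eqP; rewrite eqEcard; apply/andP; split.
      by apply/subsetP => _ /imsetP[c _ ->]; apply: hP.
    by rewrite card_imset ?card_ord ?cP //; apply/injectiveP.
  by rewrite hi imP eqxx Ppart cP eqxx.
apply/setP => h; apply/imsetP/idP => [[f + ->]|].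
  rewrite inE => /forallP hit.
  have ex c : exists i, f i = c by have /existsP[i /andP[_ /eqP]] := hit c; exists i.
  have [Ppart cP] := fibres_partition ex.
  have imF : im (F f) = fibres f by apply: eq_imset => c; rewrite ffunE.
  rewrite inE imF inE Ppart cP eqxx !andbT; apply/injectiveP => c d e.
  by have [i fi] := ex c; have := FE f c i; rewrite e FE fi eqxx => /eqP.
rewrite inE => /andP[/injectiveP hinj]; rewrite inE =>
    /andP[/and3P[/eqP cov triv n0] _].
have ex i : exists c, i \in h c.
  have : i \in cover (im h) by rewrite cov inE.
  by move=> /bigcupP[_ /imsetP[c _ ->] ?]; exists c.
have uniq_c i c d : i \in h c -> i \in h d -> c = d.
  move=> ic id; apply: hinj; apply/eqP/negPn/negP => ne.
  have him j : h j \in im h by apply/imsetP; exists j.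
  have := trivIsetP triv _ _ (him c) (him d) ne.
  by move/pred0P/(_ i); rewrite /= ic id.
pose f : {ffun 'I_k -> 'I_r} := [ffun i => xchoose (ex i)].
have fP i : i \in h (f i) by rewrite ffunE; exact: (xchooseP (ex i)).
exists f.
  rewrite inE; apply/forallP => c; have : h c != set0.
    by apply: contraNneq n0 => <-; apply/imsetP; exists c.
  by case/set0Pn => i ic; apply/existsP; exists i; rewrite inE /=; apply/eqP;
      apply: uniq_c (fP i) ic.
apply/ffunP => c; apply/setP => i; rewrite FE; apply/idP/eqP => [ic|<- //].
exact: uniq_c (fP i) ic.
Qed.

Section LevelCoefficient.
Variables (R : realFieldType) (r : nat).

(* Type [t] refers to the pair of colours [2t], [2t+1]. *)
Definition chi_type (t : nat) (c : 'I_r) : R :=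
  (c == t.*2 :> nat)%:R - (c == t.*2.+1 :> nat)%:R.

Lemma sum_eq_nat (M : {set 'I_r}) (a : 'I_r) :
  \sum_(c in M) (c == a :> nat)%:R = (a \in M)%:R :> R.
Proof.
case: (boolP (a \in M)) => aM.
  rewrite (bigD1 a) //= eqxx big1 ?addr0 // => c /andP[_ ca].
  by rewrite -[c == a :> nat]/(c == a) (negPf ca).
rewrite big1 // => c cM; case: eqP => // /val_inj e.
by rewrite -e cM in aM.
Qed.

Lemma chi_type_expn t c i : odd i -> chi_type t c ^+ i = chi_type t c.
Proof.
move=> oi; have i0 : (0 < i)%N by case: i oi.
rewrite /chi_type; case: eqP => [->|_].
  by rewrite (_ : (_ == _) = false) ?subr0 ?expr1n //; apply/eqP; lia.
case: eqP => _; rewrite /= sub0r; last by rewrite oppr0 expr0n gtn_eqF.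
by rewrite -signr_odd oi expr1.
Qed.

Lemma chi_type_sum (M : {set 'I_r}) t (a b : 'I_r) : a = t.*2 :> nat -> b = t.*2.+1 :>
    nat ->
  \sum_(c in M) chi_type t c = (a \in M)%:R - (b \in M)%:R.
Proof. by move=> ea eb; rewrite sumrB -eb -ea !sum_eq_nat. Qed.

Lemma chi_type_sum0 t : (t.*2.+1 < r)%N -> \sum_c chi_type t c = 0.
Proof.
move=> lt_b; have lt_a := ltnW lt_b.
rewrite (eq_bigl (fun c => c \in [set: 'I_r])) => [|c]; last by rewrite inE.
by rewrite (@chi_type_sum _ t (Ordinal lt_a) (Ordinal lt_b)) // !inE subrr.
Qed.

Lemma chi_type_odd t i : (t.*2.+1 < r)%N -> odd i -> \sum_c chi_type t c ^+ i = 0.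
Proof.
by move=> lt oi; under eq_bigr do rewrite chi_type_expn //; apply: chi_type_sum0.
Qed.

Lemma chi_type_le1 t c : `|chi_type t c| <= 1.
Proof.
rewrite /chi_type; case: eqP => [->|_].
  by rewrite (_ : (_ == _) = false) ?subr0 ?normr1 //; apply/eqP; lia.
by case: eqP => _; rewrite ?sub0r ?subrr ?normrN ?normr1 ?normr0 ?ler01.
Qed.

(** For a pair of colours below [r] this is the sum of [chi_type t] over the colours outside [M]: it
    is 1 or -1 if [M] contains exactly one colour of the pair, and 0 otherwise. *)
Definition missed (M : {set 'I_r}) t : R := - \sum_(c in M) chi_type t c.

Lemma sum_compl_chi (M : {set 'I_r}) t : (t.*2.+1 < r)%N ->
  \sum_c (c \notin M)%:R * chi_type t c = missed M t.
Proof.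
move=> lt; rewrite /missed; have /eqP := chi_type_sum0 lt;
    rewrite (bigID (mem M)) /= addrC addr_eq0 => /eqP <-.
rewrite [RHS]big_mkcond; apply: eq_bigr => c _.
by case: (c \in M); rewrite ?mul0r ?mul1r.
Qed.

Section Vertices.
Variables (T : finType) (ty : T -> nat).
Hypothesis ty_lt : forall v, ((ty v).*2.+1 < r)%N.
Implicit Types (f : {ffun T -> 'I_r}) (e P : {set T}) (M : {set 'I_r}).

Definition hit e f : R := (is_hit e f)%:R.

(** Inclusion-exclusion over sets [M] of colours that [e] avoids; each summand factors over the
    vertices, which makes its average computable. *)
Lemma hit_incl_excl e f :
  hit e f = \sum_(M : {set 'I_r}) (-1) ^+ #|M| * \prod_(v in e) (f v \notin M)%:R.
Proof.
pose miss c : R := \prod_(v in e) (f v != c)%:R.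
have missE c : miss c = (~~ [exists v, (v \in e) && (f v == c)])%:R.
  rewrite /miss; case: existsP => [[v /andP[ve /eqP fv]]|none].
    by rewrite (bigD1 v) //= fv eqxx mul0r.
  rewrite big1 // => v ve; case: eqP => // fv; case: none; exists v.
  by rewrite ve fv eqxx.
transitivity (\prod_c (1 - miss c)).
  rewrite /hit /is_hit; case: forallP => [all|/forallP].
    by rewrite big1 // => c _; rewrite missE (all c) subr0.
  rewrite negb_forall => /existsP[c nc].
  by rewrite (bigD1 c) //= missE nc subrr mul0r.
under eq_bigr do rewrite addrC; rewrite bigA_distr; apply: eq_bigr => M _.
rewrite -big_mkcond /= prodrN; congr (_ * _).
rewrite exchange_big; apply: eq_bigr => v _ /=.
case: (boolP (f v \in M)) => fM /=; first by rewrite (bigD1 (f v)) //= eqxx mul0r.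
by rewrite big1 // => c cM; case: eqP => // fc; rewrite fc cM in fM.
Qed.

Lemma hit01 e f : 0 <= hit e f <= 1.
Proof. by rewrite /hit; case: is_hit; rewrite ?ler01 ?lexx. Qed.

Lemma hit_indep e v : v \notin e -> indep_of v (hit e).
Proof.
move=> ve f c; rewrite /hit /is_hit; congr ((nat_of_bool _)%:R).
apply: eq_forallb => d; apply: eq_existsb => w; rewrite ffunE.
by have [->|//] := eqVneq w v; rewrite (negPf ve).
Qed.

Lemma avg_hit_mon e P : (0 < r)%N -> P \subset e ->
  avg (fun f => hit e f * mon (fun v => chi_type (ty v)) P f) =
  (\sum_(M : {set 'I_r}) (-1) ^+ #|M| * (r%:R - #|M|%:R) ^+ (#|e| - #|P|) *
     \prod_(v in P) missed M (ty v)) / r%:R ^+ #|e|.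
Proof.
move=> r0 Pe.
pose h M v (c : 'I_r) : R := (if v \in e then (c \notin M)%:R else 1) *
  (if v \in P then chi_type (ty v) c else 1).
have hE M f : \prod_v h M v (f v) =
    \prod_(v in e) (f v \notin M)%:R * mon (fun v => chi_type (ty v)) P f.
  by rewrite big_split /= -!big_mkcond.
have sumh M : \sum_(f : {ffun T -> 'I_r}) \prod_v h M v (f v) =
   r%:R ^+ (#|T| - #|e|) * ((r%:R - #|M|%:R) ^+ (#|e| - #|P|) * \prod_(v in P) missed M
       (ty v)).
  rewrite -bigA_distr_bigA /=.
  have sumv v : \sum_c h M v c = (if v \in ~: e then r%:R else 1) *
      ((if v \in e :\: P then r%:R - #|M|%:R else 1) * (if v \in P then missed M (ty v)
          else 1)).
    rewrite /h !inE; case: (boolP (v \in e)) => ve /=; last first.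
      rewrite (negPf (contra (subsetP Pe v) ve)) andbF !mulr1.
      by rewrite sumr_const card_ord.
    case: (boolP (v \in P)) => vP /=; rewrite ?mul1r; first exact: sum_compl_chi.
    under eq_bigr do rewrite mulr1; rewrite mulr1.
    apply/eqP; rewrite eq_sym subr_eq; apply/eqP.
    have -> : r%:R = \sum_(c : 'I_r) (1 : R) by rewrite sumr_const card_ord.
    have -> : #|M|%:R = \sum_(c : 'I_r) (c \in M)%:R :> R.
      by rewrite -sum1_card natr_sum big_mkcond; apply: eq_bigr => c _; case: (c \in M).
    by rewrite -big_split; apply: eq_bigr => c _; case: (c \in M);
        rewrite /= ?addr0 ?add0r.
  rewrite (eq_bigr _ (fun v _ => sumv v)) !big_split /= -!big_mkcond /= !prodr_const.
  by rewrite cardsCs setCK cardsD (setIidPr Pe).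
rewrite /avg (eq_bigr (fun f => \sum_(M : {set 'I_r}) (-1) ^+ #|M| * \prod_v h M v (f
    v))) => [|f _]; last first.
  by rewrite hit_incl_excl mulr_suml; apply: eq_bigr => M _; rewrite hE mulrA.
rewrite exchange_big /=.
under eq_bigr do rewrite -mulr_sumr sumh mulrCA.
rewrite -mulr_sumr card_ffun card_ord natrX.
have rn0 : r%:R != 0 :> R by rewrite pnatr_eq0 -lt0n.
rewrite mulrA mulrC; congr (_ * _); first by apply: eq_bigr => M _; rewrite mulrA.
have le : (#|e| <= #|T|)%N by rewrite max_card.
by rewrite -{1}(subnK le) exprD invfM mulrAC mulVf ?mul1r // expf_neq0.
Qed.

End Vertices.

(** The formula for [P] empty depends on [#|e|] only, so the average may be taken on ['I_k] itself,
    where the colourings that hit are the surjections. *)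
Lemma avg_hit (T : finType) (e : {set T}) (k : nat) : (1 < r)%N -> #|e| = k ->
  avg (hit e) = (stirling2 k r * r`!)%:R / r%:R ^+ k.
Proof.
move=> r1 ek; have r0 := ltnW r1.
have gen (V : finType) (B : {set V}) : #|B| = k -> avg (hit B) =
    (\sum_(M : {set 'I_r}) (-1) ^+ #|M| * (r%:R - #|M|%:R) ^+ k) / r%:R ^+ k.
  move=> Bk; have lt0 (v : V) : (0.*2.+1 < r)%N by [].
  have := avg_hit_mon (ty := fun=> 0%N) lt0 r0 (sub0set B).
  under eq_avg => f do rewrite /mon big_set0 mulr1.
  by move=> ->; rewrite Bk cards0 subn0; under eq_bigr do rewrite big_set0 mulr1.
rewrite (gen T e ek) -(gen _ [set: 'I_k]) ?cardsT ?card_ord // -card_surjections.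
rewrite /avg card_ffun !card_ord natrX mulrC; congr (_ / _).
rewrite -sum1_card natr_sum [RHS]big_mkcond; apply: eq_bigr => f _.
by rewrite /hit inE; case: is_hit.
Qed.

(** [n] counts the vertices of the edge outside [P], and [P] splits into [h] pairs of equal type,
    whence the squares; type [l - 1] takes all pairs left over. *)
Definition level_coef (n h l : nat) : R :=
  \sum_(M : {set 'I_r}) (-1) ^+ #|M| * (r%:R - #|M|%:R) ^+ n *
    \prod_(i < h) missed M (minn i l.-1) ^+ 2.

Lemma avg_hit_level (T : finType) (ty : T -> nat) (e P : {set T}) (h l : nat) :
  (forall v, ((ty v).*2.+1 < r)%N) -> (0 < r)%N -> P \subset e -> #|P| = h.*2 ->
  (forall y : nat -> R, \prod_(v in P) y (ty v) = \prod_(i < h) y (minn i l.-1) ^+ 2) ->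
  avg (fun f => hit e f * mon (fun v => chi_type (ty v)) P f) =
  level_coef (#|e| - h.*2) h l / r%:R ^+ #|e|.
Proof.
move=> ty_lt r0 Pe cP prodP; rewrite (avg_hit_mon ty_lt r0 Pe) cP.
by congr (_ / _); apply: eq_bigr => M _; rewrite (prodP (missed M)).
Qed.

Lemma sum_double (l : nat) (F : nat -> nat) :
  (\sum_(0 <= a < l.*2) F a = \sum_(0 <= t < l) (F t.*2 + F t.*2.+1))%N.
Proof.
elim: l => [|l IH]; first by rewrite !big_geq.
by rewrite doubleS !big_nat_recr //= IH addnA.
Qed.

Lemma card_transversal (l : nat) (M : {set 'I_r}) : (l.*2 <= r)%N ->
  (forall c : 'I_r, c \in M -> (c < l.*2)%N) ->
  (forall t, (t < l)%N -> missed M t != 0) -> #|M| = l.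
Proof.
move=> lr Ml tr; pose F a := nat_of_bool [exists c, (c \in M) && (c == a :> nat)].
have FE (a : 'I_r) : F a = (a \in M).
  rewrite /F; congr nat_of_bool; apply/existsP/idP =>
      [[c /andP[cM /eqP/val_inj <-]]//|aM].
  by exists a; rewrite aM eqxx.
have -> : #|M| = (\sum_(0 <= a < r) F a)%N.
  rewrite big_mkord -sum1_card big_mkcond; apply: eq_bigr => a _.
  by rewrite FE; case: (a \in M).
rewrite (big_cat_nat (n := l.*2)) //= [X in (_ + X)%N]big_nat_cond.
rewrite [X in (_ + X)%N]big1 => [|a]; last first.
  rewrite andbT => /andP[la ar]; rewrite (FE (Ordinal ar)).
  by case: (boolP (_ \in M)) => // /Ml; rewrite ltnNge la.
rewrite addn0 sum_double big_nat_cond (eq_bigr (fun=>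
    1%N)) -?big_nat_cond ?sum_nat_const_nat ?subn0 ?muln1 //.
move=> t; rewrite andbT => tl; have bt : (t.*2.+1 < r)%N by apply: leq_trans lr;
    move: tl; clear; lia.
have at_ := ltnW bt; have := tr t tl.
rewrite /missed (@chi_type_sum _ t (Ordinal at_) (Ordinal bt)) //.
rewrite (FE (Ordinal at_)) (FE (Ordinal bt)).
by case: (_ \in M); case: (_ \in M); rewrite ?subrr ?oppr0 ?eqxx.
Qed.

(* Expand [(r - |M|)^n] over the maps [g] whose image avoids [M].  If [g] misses a
   colour [c >= 2l], toggling [c] in [M] cancels all terms; otherwise the surviving [M]
   contain exactly one colour of each of the [l] pairs and all have sign [(-1)^l]. *)
Lemma level_coef_ge1 (n h l : nat) : (0 < l <= h)%N -> (l.*2 <= r <= n + l.*2)%N ->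
  1 <= `|level_coef n h l|.
Proof.
move=> /andP[l0 lh] /andP[lr rn].
pose Pi M : R := \prod_(i < h) missed M (minn i l.-1) ^+ 2.
pose av (g : {ffun 'I_n -> 'I_r}) (M : {set 'I_r}) : R := \prod_i (g i \notin M)%:R.
(* The sign [(-1) ^+ l] makes every inner sum over [M] nonnegative, so that a single term equal to 1
   suffices. *)
pose w (g : {ffun 'I_n -> 'I_r}) (M : {set 'I_r}) : R := (-1) ^+ l * ((-1) ^+ #|M| * av
    g M * Pi M).
have Pi_ge0 (M : {set 'I_r}) : 0 <= Pi M by apply: prodr_ge0 => i _; apply: sqr_ge0.
have av_ge0 (g : {ffun 'I_n -> 'I_r}) (M : {set 'I_r}) : 0 <=
    av g M by apply: prodr_ge0 => i _; apply: ler0n.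
have coefE : (-1) ^+ l * level_coef n h l = \sum_g \sum_(M : {set 'I_r}) w g M.
  rewrite /level_coef mulr_sumr exchange_big; apply: eq_bigr => M _.
  rewrite /= /w -mulr_sumr -mulr_suml -mulr_sumr; congr (_ * (_ * _ * _)).
  rewrite /av -(bigA_distr_bigA (fun (_ : 'I_n) (c : 'I_r) => (c \notin M)%:R)) /=.
  rewrite prodr_const card_ord; congr (_ ^+ _).
  apply/eqP; rewrite subr_eq; apply/eqP.
  have -> : r%:R = \sum_(c : 'I_r) (1 : R) by rewrite sumr_const card_ord.
  have -> : #|M|%:R = \sum_(c : 'I_r) (c \in M)%:R :> R.
    by rewrite -sum1_card natr_sum big_mkcond; apply: eq_bigr => c _; case: (c \in M).
  by rewrite -big_split; apply: eq_bigr => c _; case: (c \in M);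
      rewrite /= ?addr0 ?add0r.
have Pi_tr (M : {set 'I_r}) : Pi M != 0 -> forall t, (t < l)%N -> missed M t != 0.
  move=> nz t tl; apply: contraNneq nz => m0.
  have th := leq_trans tl lh.
  rewrite /Pi (bigD1 (Ordinal th)) //= (minn_idPl _) ?m0 ?expr0n ?mul0r //.
  by rewrite -ltnS prednK.
have nonneg (g : {ffun 'I_n -> 'I_r}) : (forall c : 'I_r, (l.*2 <=
    c)%N -> exists i, g i = c) ->
    forall M : {set 'I_r}, 0 <= w g M.
  move=> cov M; rewrite /w.
  have [P0|P0] := eqVneq (Pi M) 0; first by rewrite P0 !mulr0.
  have [a0|a0] := eqVneq (av g M) 0; first by rewrite a0 mulr0 mul0r mulr0.
  rewrite (card_transversal lr _ (Pi_tr M P0)).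
    by rewrite !mulrA -exprD -signr_odd oddD addbb expr0 mul1r mulr_ge0.
  move=> c cM; rewrite ltnNge; apply/negP => /cov[i gi].
  by case/eqP: a0; rewrite /av (bigD1 i) //= gi cM mul0r.
have toggle (g : {ffun 'I_n -> 'I_r}) : (exists c : 'I_r, (l.*2 <=
    c)%N /\ forall i, g i != c) -> \sum_(M : {set 'I_r}) w g M = 0.
  move=> [c [lc gc]].
  pose tog (M : {set 'I_r}) := if c \in M then M :\ c else c |: M.
  have togK : involutive tog.
    move=> M; rewrite /tog; case: (boolP (c \in M)) => cM.
      by rewrite setD11 setD1K.
    by rewrite setU11 setU1K.
  have in_tog (M : {set 'I_r}) d : d != c -> (d \in tog M) = (d \in M).
    by move=> dc; rewrite /tog; case: ifP => _; rewrite !inE (negPf dc).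
  have wtog (M : {set 'I_r}) : w g (tog M) = - w g M.
    have -> : w g (tog M) = (-1) ^+ l * ((-1) ^+ #|tog M| * av g M * Pi M).
      rewrite /w; congr (_ * (_ * _ * _)).
        by apply: eq_bigr => i _; rewrite in_tog.
      apply: eq_bigr => i _; congr (_ ^+ 2).
      have tl : (minn i l.-1 < l)%N by rewrite gtn_min prednK // leqnn orbT.
      have bt : ((minn i l.-1).*2.+1 < r)%N.
        by apply: leq_trans lr; move: tl; clear; lia.
      rewrite /missed; congr (- _).
      rewrite !(@chi_type_sum _ _ (Ordinal (ltnW bt)) (Ordinal bt)) //.
      rewrite !in_tog //; apply/eqP => /(congr1 val) /= e; move: lc tl; rewrite -e;
          clear; lia.
    have -> : (-1) ^+ #|tog M| = - (-1) ^+ #|M| :> R.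
      rewrite /tog; case: (boolP (c \in M)) => cM.
        by rewrite [in RHS](cardsD1 c) cM add1n exprS mulN1r opprK.
      by rewrite cardsU1 cM add1n exprS mulN1r.
    by rewrite /w; ring.
  have : \sum_(M : {set 'I_r}) w g M = - \sum_(M : {set 'I_r}) w g M.
    rewrite {1}(reindex_inj (inv_inj togK)) /= -sumrN.
    by apply: eq_bigr => M _; apply: wtog.
  move/eqP; rewrite -addr_eq0 -mulr2n mulrn_eq0 /= => /eqP //.
have sum_ge0 (g : {ffun 'I_n -> 'I_r}) : 0 <= \sum_(M : {set 'I_r}) w g M.
  case: (pickP (fun c : 'I_r => (l.*2 <= c)%N && [forall i, g i != c])) =>
      [c /andP[lc /forallP gc]|none].
    by rewrite toggle //; exists c.
  apply: sumr_ge0 => M _; apply: nonneg => c lc.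
  have := none c; rewrite lc /= => /negbT; rewrite negb_forall => /existsP[i].
  by rewrite negbK => /eqP gi; exists i.
have r1 : (1 < r)%N by apply: leq_trans lr; move: l0; clear; lia.
(* [g0] takes all colours from [2l] on, which is where [r <= n + 2l] enters. An index past the last
   colour falls back to colour 1, which is odd and so outside [M0]. *)
pose g0 : {ffun 'I_n -> 'I_r} := [ffun i : 'I_n => insubd (Ordinal r1) (l.*2 + i)%N].
pose M0 : {set 'I_r} := [set c : 'I_r | (c < l.*2)%N && ~~ odd c].
suff big1 : 1 <= \sum_(M : {set 'I_r}) w g0 M.
  have le1 : 1 <= (-1) ^+ l * level_coef n h l.
    rewrite coefE (bigD1 g0) //= (le_trans big1) // lerDl.
    by apply: sumr_ge0 => g _; apply: sum_ge0.
  apply: (le_trans le1); apply: (le_trans (ler_norm _)).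
  by rewrite normrM normrX normrN1 expr1n mul1r.
have cov0 (c : 'I_r) : (l.*2 <= c)%N -> exists i, g0 i = c.
  move=> lc; have cn : (c - l.*2 < n)%N.
    by rewrite ltn_subLR // addnC; apply: leq_trans rn.
  exists (Ordinal cn); rewrite ffunE /= subnKC //; apply: val_inj.
  by rewrite val_insubd ltn_ord.
rewrite (bigD1 M0) //= -[leLHS]addr0 lerD ?sumr_ge0 // => [|M _]; last exact: nonneg.
have missedM0 t : (t < l)%N -> missed M0 t = - 1.
  move=> tl; have bt : (t.*2.+1 < r)%N by apply: leq_trans lr; move: tl; clear; lia.
  rewrite /missed (@chi_type_sum _ t (Ordinal (ltnW bt)) (Ordinal bt)) // !inE /=.
  by rewrite ltn_double tl odd_double /= andbF subr0.
have Pi1 : Pi M0 = 1.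
  rewrite /Pi big1 // => i _; rewrite missedM0 ?sqrrN ?expr1n //.
  by rewrite gtn_min prednK // leqnn orbT.
have av1 : av g0 M0 = 1.
  rewrite /av big1 // => i _; rewrite ffunE inE val_insubd.
  case: ifP => _ /=; first by rewrite ltnNge leq_addr.
  by rewrite andbF.
rewrite /w Pi1 av1 !mulr1 (card_transversal lr) //.
- by rewrite -exprD -signr_odd oddD addbb.
- by move=> c; rewrite inE => /andP[].
- by move=> t tl; rewrite missedM0 // oppr_eq0 oner_eq0.
Qed.

End LevelCoefficient.

(** * Surplus from large codegrees *)

Definition edges_above (T : finType) (E : {set {set T}}) (Q : {set T}) : {set {set T}}
    :=
  [set e in E | Q \subset e].

Definition deg (T : finType) (E : {set {set T}}) (Q : {set T}) : nat := #|edges_above E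
    Q|.

(** The hypercontractive constant for degree 2 and exponent [2q] with [q = 3L + 1], large enough for
    [t^(2q)] to beat the bound [A^3 = B^(3L)] on the number of edges. *)
Definition pair_const (R : realFieldType) (L : nat) : R :=
  ((((3 * L).+1.*2 ^ 2) ^ 2) ^ (3 * L).+1)%:R.

Section SurplusOfPairs.
(* The uniform colouring is reweighted by the density [1 + t * hc / sigma]. *)
Variables (R : realFieldType) (T : finType) (C : finType).
Hypothesis C_gt0 : (0 < #|C|)%N.
Variable chi : T -> C -> R.
Hypothesis chi_odd : forall v i, odd i -> \sum_c chi v c ^+ i = 0.
Hypothesis chi_le1 : forall v c, `|chi v c| <= 1.
Variables (A B tau kap D sigma : R) (L : nat).
Hypotheses (B_ge1 : 1 <= B) (A_pow : A = B ^+ L).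
Hypothesis tau01 : 0 <= tau <= 1.
Variables (E : {set {set T}}) (cut : {set T} -> {ffun T -> C} -> R).
Hypothesis E_le : #|E|%:R <= A ^+ 3.
Hypothesis cut01 : forall e f, 0 <= cut e f <= 1.
Hypothesis cut_indep : forall (e : {set T}) v, v \notin e -> indep_of v (cut e).
Hypothesis cut_coef : forall (Q e : {set T}), #|Q| = 2 -> e \in E -> Q \subset e ->
  avg (fun f => cut e f * mon chi Q f) = kap.
Hypothesis cut_le : forall f,
  \sum_(e in E) cut e f <= \sum_(e in E) avg (cut e) + D.
Hypothesis sigma_gt0 : 0 < sigma.
Hypothesis sigma_sqr : sigma ^+ 2 = \sum_(Q : {set T} | #|Q| == 2) (deg E Q)%:R ^+ 2.
Implicit Types (f : {ffun T -> C}) (Q e : {set T}).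

Let q := (3 * L).+1.
Let t := tau / B.
Let sg : R := Num.sg kap.
Let F f := \sum_(e in E) cut e f.
Let mean := \sum_(e in E) avg (cut e).
Let h f : R := \sum_(Q : {set T} | #|Q| == 2) sg * (deg E Q)%:R * mon chi Q f.
Let hc f : R := if `|t * h f| <= sigma then h f else 0.

Let B_gt0 : 0 < B. Proof. exact: lt_le_trans ltr01 B_ge1. Qed.
Let tau_ge0 : 0 <= tau. Proof. by case/andP: tau01. Qed.
Let tau_le1 : tau <= 1. Proof. by case/andP: tau01. Qed.
Let t_ge0 : 0 <= t. Proof. by rewrite /t divr_ge0 // ltW. Qed.

Let avg_mon0 e Q : (0 < #|Q|)%N -> ~~ (Q \subset e) ->
  avg (fun f => cut e f * mon chi Q f) = 0.
Proof.
move=> Q0 /subsetPn[x xQ xe].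
rewrite -(avg_indep0 C_gt0 (v := x) (phi := chi x) (G := fun f =>
    cut e f * mon chi (Q :\ x) f))
  ?(chi_sum0 chi_odd) //; last by move=> f c; rewrite cut_indep // mon_indep ?setD11.
by apply: eq_avg => f; rewrite mulrCA -monU1 ?setD11 // setD1K.
Qed.

Let avg_h0 : avg h = 0.
Proof.
rewrite /h avg_sum big1 // => Q /eqP Q2; rewrite avgZ.
have /card_gt0P[x xQ] : (0 < #|Q|)%N by rewrite Q2.
rewrite [X in _ * X](_ : _ = 0) ?mulr0 //.
rewrite -(avg_indep0 C_gt0 (v := x) (phi := chi x) (G := mon chi (Q :\ x)))
  ?(chi_sum0 chi_odd) //; last by move=> f c; rewrite mon_indep ?setD11.
by apply: eq_avg => f; rewrite -monU1 ?setD11 // setD1K.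
Qed.

Let avg_Fh : avg (fun f => F f * h f) = `|kap| * sigma ^+ 2.
Proof.
rewrite sigma_sqr mulr_sumr.
transitivity (avg (fun f => \sum_(Q : {set T} | #|Q| == 2)
    sg * (deg E Q)%:R * \sum_(e in E) cut e f * mon chi Q f)).
  apply: eq_avg => f; rewrite /h mulr_sumr; apply: eq_bigr => Q _.
  by rewrite mulrCA; congr (_ * _); rewrite /F mulr_suml.
rewrite avg_sum; apply: eq_bigr => Q /eqP Q2; rewrite avgZ avg_sum.
rewrite (eq_bigr (fun e => if Q \subset e then kap else 0)) => [|e eE]; last first.
  by case: ifP => Qe; [apply: cut_coef | rewrite avg_mon0 ?Q2 ?Qe].
rewrite -big_mkcondr sumr_const /=.
rewrite (_ : #|_| = deg E Q); last by apply: eq_card => e; rewrite !inE.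
by rewrite -[kap *+ _]mulr_natr normrEsg -/sg; ring.
Qed.

Let F01 f : `|F f - mean| <= #|E|%:R.
Proof.
have F_ge0 : 0 <= F f by apply: sumr_ge0 => e _; case/andP: (cut01 e f).
have F_le : F f <= #|E|%:R.
  by rewrite -sumr_const; apply: ler_sum => e _; case/andP: (cut01 e f).
have m_ge0 : 0 <= mean.
  by apply: sumr_ge0 => e _; apply: avg_ge0 => f'; case/andP: (cut01 e f').
have m_le : mean <= #|E|%:R.
  rewrite -sumr_const; apply: ler_sum => e _; rewrite -[leRHS](avg_cst T C_gt0 1).
  by apply: ler_avg => f'; case/andP: (cut01 e f').
rewrite ler_norml; apply/andP; split; lra.
Qed.

Let tail_h f : t * `|h f - hc f| <= sigma * (t / sigma * h f) ^+ q.*2.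
Proof.
have even_ge0 : 0 <= (t / sigma * h f) ^+ q.*2 by rewrite -mul2n exprM exprn_ge0
    ?sqr_ge0.
rewrite /hc; case: ifP => [_|/negbT];
    first by rewrite subrr normr0 mulr0 mulr_ge0 // ltW.
rewrite -ltNge subr0 => big; rewrite -ler_pdivrMl //.
have -> : t * `|h f| = `|t * h f| by rewrite normrM ger0_norm.
have x1 : 1 <= `|t / sigma * h f|.
  rewrite mulrAC normrM normfV (gtr0_norm sigma_gt0) ler_pdivlMr // mul1r ltW //.
rewrite -[_ ^+ q.*2]ger0_norm // normrX.
have -> : sigma^-1 * `|t * h f| = `|t / sigma * h f|.
  by rewrite [X in _ = `|X|]mulrAC [RHS]normrM normfV (gtr0_norm sigma_gt0) mulrC.
by rewrite -[leLHS]expr1 ler_weXn2l.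
Qed.

Let moment_h : avg (fun f => h f ^+ q.*2) <= pair_const R L * sigma ^+ q.*2.
Proof.
pose a Q : R := if #|Q| == 2 then sg * (deg E Q)%:R else 0.
have -> : avg (fun f => h f ^+ q.*2) =
    avg (fun f => (\sum_(Q : {set T} | Q \subset setT) a Q * mon chi Q f) ^+ q.*2).
  apply: eq_avg => f; congr (_ ^+ _); rewrite /h big_mkcond /=.
  apply: eq_big => [Q|Q _]; first by rewrite subsetT.
  by rewrite /a; case: ifP; rewrite ?mul0r.
apply: (le_trans (hypercontractivity C_gt0 chi_odd chi_le1 setT a (isT : (0 < q)%N))).
rewrite -mul2n exprM /pair_const -/q natrX -exprMn mul2n.
have N0 : 0 <= \sum_(Q : {set T} | Q \subset setT) ((q.*2 ^ 2) ^ #|Q|)%:R * a Q ^+ 2.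
  by apply: sumr_ge0 => Q _; rewrite mulr_ge0 ?ler0n ?sqr_ge0.
rewrite lerXn2r ?nnegrE ?mulr_ge0 ?ler0n ?sqr_ge0 ?(ltW sigma_gt0) //.
rewrite sigma_sqr mulr_sumr [leRHS]big_mkcond /=.
rewrite (eq_bigl xpredT) => [|Q]; last by rewrite subsetT.
apply: ler_sum => Q _; rewrite /a; case: eqP => [->|_]; last by rewrite expr0n mulr0.
rewrite ler_wpM2l ?ler0n // exprMn ler_piMl ?sqr_ge0 //.
by rewrite -real_normK ?num_real // exprn_ile1 // /sg normr_sg; case: (kap != 0).
Qed.

(** Truncation keeps the weight between 0 and 2 but may spoil its mean, so the centred [F f - mean]
    is averaged instead; this costs the factor 2 before [D]. *)
Theorem surplus_of_pairs :
  tau / B * (`|kap| * sigma) - tau ^+ 2 / B * pair_const R L <= D *+ 2.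
Proof.
have D_ge0 : 0 <= D.
  have [f le_f] := exists_ge_avg C_gt0 F.
  by have := le_trans le_f (cut_le f); rewrite /F avg_sum lerDl.
have upper : avg (fun f => (F f - mean) * (1 + t / sigma * hc f)) <= D *+ 2.
  rewrite -[leRHS](avg_cst T C_gt0); apply: ler_avg => f.
  have : `|t / sigma * hc f| <= 1.
    rewrite /hc mulrAC; case: ifP => [le1|_];
        last by rewrite !(mulr0, mul0r) normr0 ler01.
    by rewrite normrM normfV (gtr0_norm sigma_gt0) ler_pdivrMr // mul1r.
  rewrite ler_norml => /andP[lo hi].
  have d0 : 0 <= 1 + t / sigma * hc f by lra.
  apply: (le_trans (y := D * (1 + t / sigma * hc f))).
    by rewrite ler_wpM2r // lerBlDl cut_le.
  by rewrite -[leRHS]mulr_natr ler_wpM2l //; lra.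
apply: le_trans upper.
have -> : avg (fun f => (F f - mean) * (1 + t / sigma * hc f)) =
   t / sigma * (`|kap| * sigma ^+ 2) - sigma^-1 * avg (fun f =>
       (F f - mean) * (t * (h f - hc f))).
  rewrite -avg_Fh -!avgZ -avgB.
  transitivity (avg (fun f => (F f - mean) + ((t / sigma * (F f * h f) -
     sigma^-1 * ((F f - mean) * (t * (h f - hc f)))) - t / sigma * mean * h f))).
    by apply: eq_avg => f; ring.
  rewrite [LHS]avgD [X in X + _ = _]avgB [X in _ + X = _]avgB.
  rewrite [X in _ + (_ - X) = _]avgZ avg_h0 mulr0 subr0 (avg_cst T C_gt0).
  by rewrite /F avg_sum -/mean subrr add0r.
apply: lerB.
  by rewrite -/t; apply: eq_ler; field; rewrite gt_eqF.
rewrite ler_pdivrMl //; apply: (le_trans (ler_norm _));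
    apply: (le_trans (ler_norm_avg _)).
apply: (le_trans (y := avg (fun f =>
    #|E|%:R * sigma * (t / sigma) ^+ q.*2 * h f ^+ q.*2))).
  apply: ler_avg => f; rewrite normrM -[leRHS]mulrA -exprMn -[leRHS]mulrA.
  apply: ler_pM => //; rewrite [leLHS](_ : _ = t * `|h f - hc f|) ?tail_h //.
  by rewrite normrM ger0_norm.
rewrite avgZ; apply: (le_trans (ler_wpM2l _ moment_h)).
  have ts_ge0 : 0 <= t / sigma by rewrite mulr_ge0 // invr_ge0 ltW.
  have Es_ge0 : 0 <= #|E|%:R * sigma by rewrite mulr_ge0 ?ler0n // ltW.
  by rewrite mulr_ge0 // exprn_ge0.
have -> : #|E|%:R * sigma * (t / sigma) ^+ q.*2 * (pair_const R L * sigma ^+ q.*2) =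
   sigma * pair_const R L * (#|E|%:R * t ^+ q.*2).
  by rewrite expr_div_n; field; rewrite expf_neq0 ?gt_eqF.
have -> : sigma * (tau ^+ 2 / B * pair_const R L) = sigma * pair_const R L * (tau ^+ 2
    / B) by ring.
apply: ler_wpM2l.
  by rewrite mulr_ge0 ?(ltW sigma_gt0) // /pair_const ler0n.
apply: (le_trans (ler_wpM2r _ E_le)); first by rewrite exprn_ge0.
have -> : A ^+ 3 * t ^+ q.*2 = tau ^+ q.*2 * (B ^+ (3 * L) / B ^+ q.*2).
  by rewrite /t expr_div_n A_pow -exprM mulnC; field; rewrite expf_neq0 ?gt_eqF.
apply: ler_pM; rewrite ?exprn_ge0 ?divr_ge0 ?exprn_ge0 ?(ltW B_gt0) //.
  by rewrite ler_wiXn2l // /q -mul2n leq_pmulr.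
rewrite ler_pdivrMr ?exprn_gt0 // ler_pdivlMl // -exprS ler_weXn2l // /q.
by clear; lia.
Qed.

End SurplusOfPairs.

(** * Selecting a tight family *)

Lemma subset_of_card (T : finType) (A : {set T}) (n : nat) : (n <= #|A|)%N ->
  exists2 B : {set T}, B \subset A & #|B| = n.
Proof.
move=> nA; exists [set x in take n (enum A)].
  by apply/subsetP => x; rewrite inE => /mem_take; rewrite mem_enum.
rewrite cardsE; have /card_uniqP -> := take_uniq n (enum_uniq (mem A)).
by rewrite size_take_min -cardE (minn_idPl nA).
Qed.

Section Degrees.
Variables (T : finType) (E : {set {set T}}).
Implicit Types (e Q S : {set T}) (v w : T).

Lemma deg_subset Q S : Q \subset S -> (deg E S <= deg E Q)%N.
Proof.
move=> QS; apply/subset_leq_card/subsetP => e; rewrite !inE => /andP[-> /=].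
exact: subset_trans.
Qed.

Lemma deg_gt0 Q e : e \in E -> Q \subset e -> (0 < deg E Q)%N.
Proof. by move=> eE Qe; apply/card_gt0P; exists e; rewrite inE eE. Qed.

Lemma sum_deg1 : (\sum_v deg E [set v] = \sum_(e in E) #|e|)%N.
Proof.
have degE v : deg E [set v] = (\sum_(e in E) (v \in e))%N.
  rewrite /deg -sum1_card big_mkcond [RHS]big_mkcond; apply: eq_bigr => e _ /=.
  by rewrite inE sub1set; case: (e \in E) => //=; case: (v \in e).
rewrite (eq_bigr _ (fun v _ => degE v)) exchange_big /=; apply: eq_bigr => e _.
by rewrite -sum1_card [RHS]big_mkcond; apply: eq_bigr => v _; case: (v \in e).
Qed.

End Degrees.

(** * Light edges: small codegrees and at most one heavy vertex *)

Section Cleaning.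
Variables (R : realFieldType) (T : finType) (E : {set {set T}}).
Variables (A : R) (k : nat).
Hypotheses (A_gt0 : 0 < A) (k_gt0 : (0 < k)%N).
Hypothesis card_E : forall e, e \in E -> #|e| = k.
Hypothesis E_eq : #|E|%:R = A ^+ 3.
Implicit Types (e Q S : {set T}) (v w : T).

Definition heavy v : bool := 2 * k%:R * A ^+ 2 < (deg E [set v])%:R.

Definition light_edges : {set {set T}} :=
  [set e in E | [forall Q : {set T}, (Q \subset e) && (#|Q| == 2)%N ==>
      ((deg E Q)%:R <= A)]
     && [forall v, forall w, (v \in e) && (w \in e) && heavy v && heavy w ==>
         (v == w)]].

Lemma card_heavy : #|[set v | heavy v]|%:R <= A / 2.
Proof.
have k0 : 0 < k%:R :> R by rewrite ltr0n.
have := sum_deg1 E; rewrite [RHS](eq_bigr (fun=> k)) // sum_nat_const =>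
    /(congr1 (fun n => n%:R : R)).
rewrite natrM E_eq natr_sum => sumE.
have : #|[set v | heavy v]|%:R * (2 * k%:R * A ^+ 2) <= A ^+ 3 * k%:R.
  rewrite -sumE mulr_natl -sumr_const [leRHS](bigID (fun v =>
      v \in [set v | heavy v])) /=.
  rewrite ler_wpDr ?sumr_ge0 //; apply: ler_sum => v; rewrite inE; exact: ltW.
have -> : A ^+ 3 * k%:R = A / 2 * (2 * k%:R * A ^+ 2) by field.
by rewrite ler_pM2r // !mulr_gt0 ?exprn_gt0.
Qed.

(** If half of the edges contain a pair of codegree above [A], these codegrees sum to at least
    [A^3 / 2] and their squares to [A] times as much. Otherwise at most [A / 2] heavy vertices form
    at most [A^2 / 4] ordered pairs, each in at most [A] of the other edges, and a quarter of the
    edges survives. *)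
Lemma pairs_or_light_edges :
  A ^+ 4 / 2 <= \sum_(Q : {set T} | #|Q| == 2) (deg E Q)%:R ^+ 2 \/
  A ^+ 3 / 4 <= #|light_edges|%:R.
Proof.
pose bad1 := [set e in E | [exists Q : {set T}, [&& Q \subset e, #|Q| == 2%N & A < (deg
    E Q)%:R]]].
have [le1|lt1] := leP (A ^+ 3 / 2) (#|bad1|%:R : R).
  left; pose HP := [set Q : {set T} | (#|Q| == 2%N) && (A < (deg E Q)%:R)].
  have cov : #|bad1|%:R <= \sum_(Q in HP) (deg E Q)%:R :> R.
    rewrite -natr_sum ler_nat; apply: (@leq_trans #|\bigcup_(Q in HP) edges_above E Q|).
      apply/subset_leq_card/subsetP => e; rewrite inE =>
          /andP[eE /existsP[Q /and3P[Qe Q2 dQ]]].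
      by apply/bigcupP; exists Q; rewrite inE ?Q2 // eE.
    elim/big_ind2: _ => [|D n D' n' Dn Dn'|//]; first by rewrite cards0.
    exact: leq_trans (leq_card_setU _ _) (leq_add Dn Dn').
  apply: (le_trans (y := A * \sum_(Q in HP) (deg E Q)%:R)).
    have -> : A ^+ 4 / 2 = A * (A ^+ 3 / 2) by ring.
    by rewrite ler_wpM2l ?(ltW A_gt0) // (le_trans le1).
  rewrite mulr_sumr big_mkcond [leRHS]big_mkcond; apply: ler_sum => Q _ /=.
  rewrite inE; case: eqP => //= _; case: ifP => dQ; last exact: sqr_ge0.
  by rewrite expr2 ler_wpM2r ?ler0n // ltW.
right; pose bad2 := [set e in E :\: bad1 | [exists v, [exists w,
  [&& v \in e, w \in e, heavy v, heavy w & v != w]]]].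
have sub : E \subset bad1 :|: bad2 :|: light_edges.
  apply/subsetP => e eE; rewrite in_setU; case: (boolP (e \in bad1 :|: bad2)) => //=.
  rewrite in_setU negb_or => /andP[nb1 nb2]; rewrite inE eE /=.
  apply/andP; split.
    apply/forallP => Q; apply/implyP => /andP[Qe Q2]; rewrite leNgt; apply/negP => dQ.
    by case/negP: nb1; rewrite inE eE; apply/existsP; exists Q; rewrite Qe Q2.
  apply/forallP => v; apply/forallP => w; apply/implyP =>
      /andP[/andP[/andP[ve we] hv] hw].
  apply/negPn/negP => vw; case/negP: nb2; rewrite inE inE nb1 eE /=.
  by apply/existsP; exists v; apply/existsP; exists w; apply/and5P.
have le2 : #|bad2|%:R <= A ^+ 3 / 4 :> R.
  pose H := [set v | heavy v].
  apply: (le_trans (y := #|setX H H|%:R * A)).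
    apply: (card_cover_le (G := fun i : T * T =>
        [set e in bad2 | [&& i.1 \in e, i.2 \in e & i.1 != i.2]])).
      move=> e eb; move: (eb); rewrite inE =>
          /andP[_ /existsP[v /existsP[w /and5P[ve we hv hw vw]]]].
      exists (v, w); first by rewrite !inE hv hw.
      by rewrite in_set eb ve we vw.
    case=> v w _ /=.
    case: (set_0Vmem [set e in bad2 | [&& v \in e, w \in e & v != w]]) => [->|[e]].
      by rewrite cards0 ltW.
    rewrite inE => /andP[+ /and3P[ve we vw]].
    rewrite inE => /andP[+ _]; rewrite inE => /andP[nb1 eE].
    have dvw : (deg E [set v; w])%:R <= A.
      rewrite leNgt; apply/negP => dvw; case/negP: nb1; rewrite inE eE.
      by apply/existsP; exists [set v; w]; rewrite dvw cards2 vw subUset !sub1set ve we.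
    apply: le_trans dvw; rewrite ler_nat; apply/subset_leq_card/subsetP => e'.
    rewrite in_set => /andP[+ /and3P[ve' we' _]]; rewrite inE => /andP[+ _].
    by rewrite in_setD => /andP[_ e'E]; rewrite inE e'E subUset !sub1set ve' we'.
  rewrite cardsX natrM; have le := card_heavy.
  have -> : A ^+ 3 / 4 = A / 2 * (A / 2) * A by field.
  by rewrite ler_wpM2r ?(ltW A_gt0) // ler_pM ?ler0n.
have := subset_leq_card sub; rewrite -(ler_nat R) E_eq => tot.
have := (leq_card_setU (bad1 :|: bad2) light_edges).1; rewrite -(ler_nat R) natrD => u1.
have := (leq_card_setU bad1 bad2).1; rewrite -(ler_nat R) natrD => u2.
lra.
Qed.

End Cleaning.

(** * Tight sets at a flat level of the degrees *)

Section FlatLevel.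
Variables (R : realFieldType) (T : finType) (E : {set {set T}}).
Variables (A B : R) (k j0 L : nat).
Hypotheses (B_ge1 : 1 <= B) (A_pow : A = B ^+ L) (k_gt0 : (0 < k)%N).
Hypotheses (j0_gt1 : (1 < j0)%N) (k_big : (j0 ^ L < k)%N) (L_gt0 : (0 < L)%N).
Hypothesis card_E : forall e, e \in E -> #|e| = k.
Implicit Types (e Q S : {set T}) (u v w : T).

Let B_gt0 : 0 < B. Proof. exact: lt_le_trans ltr01 B_ge1. Qed.
Let A_ge1 : 1 <= A. Proof. by rewrite A_pow exprn_ege1. Qed.
Let A_gt0 : 0 < A. Proof. exact: lt_le_trans ltr01 A_ge1. Qed.

Definition flat (i : nat) e : bool :=
  [forall Q : {set T}, (Q \subset e) && (#|Q| == (j0 ^ i).+1) ==> ((deg E Q)%:R <=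
      B ^+ (L - i))]
  && [exists Q : {set T}, [&& Q \subset e, #|Q| == (j0 ^ i.+1).+1 & B ^+ (L - i.+1) <=
      (deg E Q)%:R]].

(* Otherwise all degrees at level [i] are below [B^(L-i)] by induction on [i], hence
   below [1] at level [L]. *)
Lemma flat_exists e : e \in light_edges E A k -> exists i : 'I_L, flat i e.
Proof.
rewrite inE => /andP[eE /andP[/forallP lightQ _]].
case: (pickP (fun i : 'I_L => flat i e)) => [i fi|none]; first by exists i.
(* Lightness gives only a weak inequality at level 0; the strict one is what contradicts a positive
   degree at level [L]. *)
have all_small i : (i <= L)%N -> forall Q : {set T}, Q \subset e -> #|Q| = (j0 ^ i).+1
    ->
    (deg E Q)%:R <= B ^+ (L - i) /\ ((0 < i)%N -> (deg E Q)%:R < B ^+ (L - i)).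
  elim: i => [|i IH] iL Q Qe Qc.
    by split=> //; rewrite subn0 -A_pow; apply: (implyP (lightQ Q));
        rewrite Qe Qc expn0.
  suff lt : (deg E Q)%:R < B ^+ (L - i.+1) by split=> // ; apply: ltW.
  rewrite ltNge; apply/negP => big; have /negP[] := negbT (none (Ordinal iL)).
  rewrite /flat /=; apply/andP; split.
    apply/forallP => Q'; apply/implyP => /andP[Q'e /eqP Q'c].
    by case: (IH (ltnW iL) Q' Q'e Q'c).
  by apply/existsP; exists Q; rewrite Qe Qc eqxx.
have [Q Qe Qc] : exists2 Q : {set T}, Q \subset e & #|Q| = (j0 ^ L).+1.
  by apply: subset_of_card; rewrite card_E.
have := (all_small L (leqnn L) Q Qe Qc).2 L_gt0.
rewrite subnn expr0 -[1]/(1%:R) ltr_nat ltnS leqn0 => /eqP dQ0.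
by have := deg_gt0 eE Qe; rewrite dQ0.
Qed.

Section Family.
Variable i : 'I_L.

Definition flat_edges := [set e in light_edges E A k | flat i e].

Let s := (j0 ^ i.+1)%N.
Let w0 := B ^+ (L - i.+1).

Definition candidate u S : bool :=
  [&& u \notin S, #|S| == s, ~~ heavy E A k u, w0 <= (deg E (u |: S))%:R
    & [exists e, (e \in flat_edges) && (u |: S \subset e)]].

Definition tight_sets : {set {set T}} := [set S | [exists u, candidate u S]].

Variable v0 : T.

Definition tight_apex S : T := odflt v0 [pick u | candidate u S].

Lemma tight_apexP S : S \in tight_sets -> candidate (tight_apex S) S.
Proof.
rewrite inE => /existsP[u cu]; rewrite /tight_apex.
by case: pickP => [//|none]; rewrite none in cu.
Qed.

Let w0_ge1 : 1 <= w0. Proof. by rewrite exprn_ege1. Qed.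

Let w0B : w0 * B = B ^+ (L - i).
Proof. by rewrite /w0 -exprSr subnSK. Qed.

Lemma flat_edgesP e : e \in flat_edges ->
  [/\ e \in E, forall Q, Q \subset e -> #|Q| = 2 -> (deg E Q)%:R <= A,
     forall v w, v \in e -> w \in e -> heavy E A k v -> heavy E A k w -> v = w,
     forall Q, Q \subset e -> (j0 ^ i < #|Q|)%N -> (deg E Q)%:R <= w0 * B
   & exists Q : {set T}, [/\ Q \subset e, #|Q| = s.+1 & w0 <= (deg E Q)%:R]].
Proof.
rewrite inE => /andP[]; rewrite inE => /andP[eE /andP[/forallP light /forallP two]].
move=> /andP[/forallP fl /existsP[Q /and3P[Qe /eqP Qc dQ]]]; split=> //.
- by move=> Q' Q'e Q'2; apply: (implyP (light Q')); rewrite Q'e Q'2.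
- move=> v w ve we hv hw; apply/eqP; have /forallP/(_ w)/implyP := two v; apply.
  by rewrite ve we hv hw.
- move=> Q' Q'e lt; have [Q2 Q2Q Q2c] := subset_of_card lt.
  apply: (le_trans (y := (deg E Q2)%:R)); first by rewrite ler_nat deg_subset.
  by rewrite w0B; apply: (implyP (fl Q2)); rewrite (subset_trans Q2Q Q'e) Q2c eqxx.
- by exists Q.
Qed.

(** [S] alone has [j0^(i+1) > j0^i] vertices, so flatness bounds its degree by [w0 * B], whereas
    with its apex it still has degree at least [w0]. *)
Lemma deg_tight_le S : S \in tight_sets -> (deg E S)%:R <=
    B * (deg E (tight_apex S |: S))%:R.
Proof.
move=> /tight_apexP /and5P[_ /eqP Sc _ dP /existsP[e /andP[/flat_edgesP[eE _ _ small _]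
    Se]]].
apply: (le_trans (y := w0 * B)).
  apply: small; first by apply: subset_trans Se; apply: subsetUr.
  by rewrite Sc /s ltn_exp2l.
by rewrite mulrC ler_wpM2l // ltW.
Qed.

(** Every flat edge contains a tight set: its witness [Q] has at least two vertices, at most one of
    them heavy, and removing one that is not heavy leaves a tight set. *)
Lemma sum_tight_ge : #|flat_edges|%:R <=
    B * (\sum_(S in tight_sets) deg E (tight_apex S |: S))%:R.
Proof.
rewrite natr_sum mulr_sumr.
apply: (le_trans (y := \sum_(S in tight_sets) (deg E S)%:R)); last first.
  by apply: ler_sum => S; apply: deg_tight_le.
rewrite -natr_sum ler_nat; apply: (@leq_trans #|\bigcup_(S in tight_sets) edges_above E
    S|).
  apply/subset_leq_card/subsetP => e ef;
      have [eE _ two _ [Q [Qe Qc dQ]]] := flat_edgesP ef.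
  have [u uQ lu] : exists2 u, u \in Q & ~~ heavy E A k u.
    case: (pickP (fun u => (u \in Q) && ~~ heavy E A k u)) => [u /andP[? ?]|none];
        first by exists u.
    have all_heavy u : u \in Q -> heavy E A k u.
      by move=> uQ; move: (none u); rewrite uQ /= => /negbFE.
    have : (1 < #|Q|)%N by rewrite Qc ltnS expn_gt0 (ltnW j0_gt1).
    move=> /card_gt1P[u [v [uQ vQ /eqP[]]]].
    by apply: two; rewrite ?(subsetP Qe) // all_heavy.
  apply/bigcupP; exists (Q :\ u).
    rewrite inE; apply/existsP; exists u; rewrite /candidate setD11 setD1K // lu dQ /=.
    move: Qc; rewrite (cardsD1 u) uQ add1n => -[->]; rewrite eqxx /=.
    by apply/existsP; exists e; rewrite ef.
  by rewrite inE eE (subset_trans (subD1set _ _)).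
elim/big_ind2: _ => [|D n D' n' Dn Dn'|//]; first by rewrite cards0.
exact: leq_trans (leq_card_setU _ _) (leq_add Dn Dn').
Qed.

(** Double counting of sets and edges: each [S] with its apex lies in at least [w0] edges, all above
    [W], and an edge has only [2 ^ k] subsets. *)
Lemma card_tight_above (F : {set {set T}}) (W : {set T}) : F \subset tight_sets ->
  (forall S, S \in F -> W \subset tight_apex S |: S) ->
  #|F|%:R * w0 <= (2 ^ k)%:R * (deg E W)%:R.
Proof.
move=> Ft FW; apply: (le_trans (y := (\sum_(S in F) deg E (tight_apex S |: S))%:R)).
  rewrite natr_sum mulr_natl -sumr_const; apply: ler_sum => S SF.
  by have /tight_apexP/and5P[] := subsetP Ft S SF.
rewrite -natrM ler_nat.
have -> : (\sum_(S in F) deg E (tight_apex S |: S) =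
    \sum_(e in E) #|[set S in F | tight_apex S |: S \subset e]|)%N.
  transitivity (\sum_(S in F) \sum_(e in E) (tight_apex S |: S \subset e))%N.
    apply: eq_bigr => S _; rewrite /deg -sum1_card big_mkcond [RHS]big_mkcond.
    by apply: eq_bigr => e _ /=; rewrite inE; case: (e \in E) => //=;
        case: (_ \subset e).
  rewrite exchange_big /=; apply: eq_bigr => e _.
  rewrite -sum1_card big_mkcond [RHS]big_mkcond.
  by apply: eq_bigr => S _ /=; rewrite inE; case: (S \in F) => //=; case: (_ \subset e).
apply: (@leq_trans (\sum_(e in edges_above E W) 2 ^ k));
    last by rewrite sum_nat_const mulnC.
rewrite big_mkcond [leqRHS]big_mkcond; apply: leq_sum => e _ /=; rewrite inE.
case: (boolP (e \in E)) => //= eE; case: ifP => We.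
  rewrite -(card_E eE) -card_powerset; apply/subset_leq_card/subsetP => S.
  by rewrite !inE subUset => /andP[_ /andP[_ ->]].
rewrite leqn0 cards_eq0; apply/eqP/setP => S; rewrite in_set0 inE.
apply/negP => /andP[SF Pe]; move: We; rewrite (subset_trans _ Pe) //.
exact: FW.
Qed.

Let C0 : R := (2 ^ k * (2 * k))%:R.

Variable SS : {set {set T}}.
Hypothesis SS_tight : SS \subset tight_sets.

Let above_le (F : {set {set T}}) (W : {set T}) (b : R) : F \subset tight_sets ->
  (forall S, S \in F -> W \subset tight_apex S |: S) ->
  (forall S, S \in F -> (deg E W)%:R <= b * w0) -> 0 <= b -> #|F|%:R <= (2 ^ k)%:R * b.
Proof.
move=> Ft FW Fb b0; have w00 : 0 < w0 := lt_le_trans ltr01 w0_ge1.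
case: (set_0Vmem F) => [->|[S SF]]; first by rewrite cards0 mulr_ge0 ?ler0n.
rewrite -(ler_pM2r w00) (le_trans (card_tight_above Ft FW)) // -mulrA.
by rewrite ler_wpM2l ?ler0n // (Fb S).
Qed.

Let k1 : 1 <= k%:R :> R. Proof. by rewrite ler1n. Qed.

(** The three link bounds differ in [W] only: here an apex that is not heavy, next a pair of
    codegree at most [A], last [v |: Q], which has more than [j0 ^ i] vertices and so degree at most
    [w0 * B]. *)
Lemma tight_link1 v : #|link SS tight_apex v|%:R <= C0 * A ^+ 2.
Proof.
have Lt : link SS tight_apex v \subset tight_sets.
  by apply: subset_trans SS_tight; apply/subsetP => S; rewrite inE => /andP[].
rewrite /C0 natrM -mulrA; apply: (above_le (W := [set v])) => //.
- by move=> S; rewrite inE sub1set => /andP[_ /eqP <-]; rewrite setU11.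
- move=> S SL; have /tight_apexP/and5P[_ _ + _ _] := subsetP Lt S SL.
  move: SL; rewrite inE => /andP[_ /eqP ->]; rewrite /heavy -leNgt natrM => le.
  have nonneg : 0 <= 2 * k%:R * A ^+ 2 by rewrite mulr_ge0 ?sqr_ge0 // mulr_ge0 ?ler0n.
  by apply: (le_trans le); rewrite ler_peMr.
- by rewrite mulr_ge0 ?ler0n ?sqr_ge0.
Qed.

Let C0_ge b : 0 <= b -> (2 ^ k)%:R * b <= C0 * b.
Proof.
move=> b0; rewrite /C0 natrM -mulrA ler_wpM2l ?ler0n // ler_peMl // ler1n.
by rewrite muln_gt0.
Qed.

Lemma tight_link2 v x : #|[set S in link SS tight_apex v | x \in S]|%:R <= C0 * A.
Proof.
apply: le_trans (C0_ge (ltW A_gt0)); apply: (above_le (W := [set v; x])).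
- by apply: subset_trans SS_tight; apply/subsetP => S; rewrite !inE => /andP[/andP[]].
- move=> S; rewrite !inE => /andP[/andP[_ /eqP <-] xS].
  by rewrite subUset !sub1set setU11 inE xS orbT.
- move=> S; rewrite !inE => /andP[/andP[SS1 /eqP <-] xS].
  have /tight_apexP/and5P[uS _ _ _ /existsP[e /andP[/flat_edgesP[_ pair _ _ _] Pe]]] :=
      subsetP SS_tight S SS1.
  apply: (le_trans (y := A)); last by rewrite ler_peMr // ltW.
  apply: pair.
    by apply: subset_trans Pe; rewrite subUset !sub1set setU11 inE xS orbT.
  by rewrite cards2 (_ : _ != x) //; apply: contraNneq uS => ->.
- exact: ltW.
Qed.

Lemma tight_link3 v Q : (s <= j0 * #|Q|)%N ->
  #|[set S in link SS tight_apex v | Q \subset S]|%:R <= C0 * B.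
Proof.
move=> big; apply: le_trans (C0_ge (ltW B_gt0)); apply: (above_le (W := v |: Q)).
- by apply: subset_trans SS_tight; apply/subsetP => S; rewrite !inE => /andP[/andP[]].
- by move=> S; rewrite !inE => /andP[/andP[_ /eqP <-] QS]; apply: setUS.
- move=> S; rewrite !inE => /andP[/andP[SS1 /eqP <-] QS].
  have /tight_apexP/and5P[uS _ _ _ /existsP[e /andP[/flat_edgesP[_ _ _ small _] Pe]]]
      := subsetP SS_tight S SS1.
  rewrite mulrC; apply: small; first by apply: subset_trans Pe; apply: setUS.
  rewrite cardsU1 (contra (subsetP QS _) uS) add1n ltnS.
  by rewrite -(leq_pmul2l (m := j0)) ?(ltnW j0_gt1) // -expnS.
- exact: ltW.
Qed.

Lemma tight_card S : S \in SS -> #|S| = s.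
Proof. by move=> /(subsetP SS_tight)/tight_apexP/and5P[_ /eqP]. Qed.

Lemma tight_apex_notin S : S \in SS -> tight_apex S \notin S.
Proof. by move=> /(subsetP SS_tight)/tight_apexP/and5P[]. Qed.

End Family.
End FlatLevel.

(** * Random roles of the vertices *)

Section Rainbow.
Variables (T : finType) (s : nat).
Implicit Types (rho : {ffun T -> 'I_s.+1}) (S : {set T}) (u : T).

Definition rainbow rho u S : bool :=
  (rho u == ord0) && dinjectiveb rho (mem (u |: S)).

Lemma rainbowP rho u S :
  reflect (rho u = ord0 /\ {in u |: S &, injective rho}) (rainbow rho u S).
Proof. by apply: (iffP andP) => -[/eqP ? /dinjectiveP]. Qed.

(** Overwriting the roles on [u |: S] by positions in the list [sq] gives a rainbow assignment;
    recording the old values in a map from ['I_s.+1] to itself costs the factor. *)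
Lemma card_rainbow u S : u \notin S -> #|S| = s ->
  (#|{ffun T -> 'I_s.+1}| <= s.+1 ^ s.+1 * #|[set rho | rainbow rho u S]|)%N.
Proof.
move=> uS cS; pose sq := u :: enum S.
have size_sq : size sq = s.+1 by rewrite /= -cardE cS.
have mem_sq v : (v \in sq) = (v \in u |: S) by rewrite !inE mem_enum.
pose b v : 'I_s.+1 := inord (index v sq).
have bE v : v \in u |: S -> b v = index v sq :> nat.
  by move=> vP; rewrite inordK // -size_sq index_mem mem_sq.
pose Phi rho : {ffun T -> 'I_s.+1} * {ffun 'I_s.+1 -> 'I_s.+1} :=
  ([ffun v => if v \in u |: S then b v else rho v], [ffun i : 'I_s.+1 =>
      rho (nth u sq i)]).
have Phi_inj : injective Phi.
  move=> rho rho' [/ffunP e1 /ffunP e2]; apply/ffunP => v.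
  have := e1 v; rewrite !ffunE; case: ifP => // vP _.
  have := e2 (b v); rewrite !ffunE bE // nth_index ?mem_sq //.
rewrite -[leqLHS](card_imset _ Phi_inj).
have -> : (s.+1 ^ s.+1 = #|[set: {ffun 'I_s.+1 -> 'I_s.+1}]|)%N.
  by rewrite cardsT card_ffun !card_ord.
rewrite mulnC -cardsX; apply/subset_leq_card/subsetP => _ /imsetP[rho _ ->].
rewrite inE [_ \in [set: _]]inE andbT inE; apply/rainbowP; split=> /=.
  by rewrite ffunE setU11; apply: ord_inj; rewrite bE ?setU11 //= eqxx.
move=> v w vP wP; rewrite !ffunE vP wP => /(congr1 val) /=; rewrite !bE //.
by move=> e; rewrite -(nth_index u (_ : v \in sq)) ?mem_sq // e nth_index ?mem_sq.
Qed.

Lemma rainbow_exists (FS : {set {set T}}) (apex : {set T} -> T) (w : {set T} -> nat) :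
  (forall S, S \in FS -> apex S \notin S) -> (forall S, S \in FS -> #|S| = s) ->
  exists rho, (\sum_(S in FS) w S <=
    s.+1 ^ s.+1 * \sum_(S in FS | rainbow rho (apex S) S) w S)%N.
Proof.
move=> aS cS; have C_gt0 : (0 < #|'I_s.+1|)%N by rewrite card_ord.
pose G rho : rat := (s.+1 ^ s.+1 * \sum_(S in FS | rainbow rho (apex S) S) w S)%:R.
have [rho le_rho] := exists_ge_avg C_gt0 G; exists rho.
rewrite -(ler_nat rat); apply: le_trans le_rho.
have Om_gt0 := card_colouring_gt0 rat T C_gt0.
rewrite /avg ler_pdivlMl // -natr_sum -natrM ler_nat -big_distrr /=.
rewrite mulnC big_distrl /=.
under [X in (_ <= _ * X)%N]eq_bigr do rewrite big_mkcondr.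
rewrite exchange_big big_distrr /=; apply: leq_sum => S SF.
rewrite -big_mkcond /= sum_nat_const mulnA mulnC leq_mul2r; apply/orP; right.
apply: leq_trans (card_rainbow (aS S SF) (cS S SF)) _.
by rewrite leq_mul2l subset_leq_card ?orbT //; apply/subsetP => x; rewrite inE.
Qed.

End Rainbow.

Lemma prod_double (R : comPzRingType) (h : nat) (Y : nat -> R) :
  \prod_(j < h.*2) Y j./2 = \prod_(i < h) Y i ^+ 2.
Proof.
elim: h => [|h IH]; first by rewrite !big_ord0.
by rewrite doubleS !big_ord_recr /= IH uphalf_double doubleK -mulrA -expr2.
Qed.

(** * The surplus bound *)

Section Assembly.
Variables (R : realFieldType) (k L j0 : nat).
Hypotheses (j0_odd : odd j0) (j0_gt1 : (1 < j0)%N) (L_gt0 : (0 < L)%N).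
Hypotheses (L_j0 : (L < j0.*2)%N) (k_big : ((j0 ^ L).+1 < k)%N).

Definition link_const : R := (2 ^ k * (2 * k))%:R.

(** The size [s] depends on the flat level, hence on the hypergraph; summing over all [s < k]
    removes this dependence. *)
Definition max_loss : R := \sum_(s < k) loss_const k s L link_const.

Let k_gt0 : (0 < k)%N. Proof. exact: leq_ltn_trans (leq0n _) k_big. Qed.

Lemma link_const_ge1 : 1 <= link_const.
Proof. by rewrite ler1n muln_gt0 expn_gt0 muln_gt0 k_gt0. Qed.

Lemma loss_const_ge0 s : 0 <= loss_const k s L link_const.
Proof.
have C0 : 0 <= link_const := le_trans ler01 link_const_ge1.
have G0 kappa := le_trans ler01 (fam_const_ge1 kappa link_const_ge1).
rewrite /loss_const mulr_ge0 ?ler0n // addr_ge0 //.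
  by rewrite /count_const mulr_ge0 ?exprn_ge0 // addr_ge0 ?mulr_ge0 ?exprn_ge0 ?ler0n.
by rewrite /tail_const mulr_ge0 ?mulr_ge0 ?exprn_ge0 ?mulr_ge0 ?ler0n.
Qed.

Variables (r : nat) (T : finType) (E : {set {set T}}) (A B D tau : R).
Hypothesis r_range : (2 <= r <= k)%N.
Hypothesis card_E : forall e, e \in E -> #|e| = k.
Hypotheses (B_ge1 : 1 <= B) (A_pow : A = B ^+ L) (E_eq : #|E|%:R = A ^+ 3).
Hypothesis tau01 : 0 <= tau <= 1.
Hypothesis cut_le : forall f : {ffun T -> 'I_r},
  \sum_(e in E) hit R e f <= \sum_(e in E) avg (@hit R r T e) + D.

Let B_gt0 : 0 < B. Proof. exact: lt_le_trans ltr01 B_ge1. Qed.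
Let A_ge1 : 1 <= A. Proof. by rewrite A_pow exprn_ege1. Qed.
Let A_gt0 : 0 < A. Proof. exact: lt_le_trans ltr01 A_ge1. Qed.
Let r_gt1 : (1 < r)%N. Proof. by case/andP: r_range. Qed.
Let r_gt0 : (0 < r)%N. Proof. exact: ltnW. Qed.
Let card_r : (0 < #|'I_r|)%N. Proof. by rewrite card_ord. Qed.
Let tau_ge0 : 0 <= tau. Proof. by case/andP: tau01. Qed.

Let kap_ge n h l : (0 < l <= h)%N -> (l.*2 <= r <= n + l.*2)%N ->
  k%:R ^- k <= `|level_coef R r n h l / r%:R ^+ k|.
Proof.
move=> lh lr; rewrite normrM normfV normrX normr_nat.
apply: (le_trans (y := 1 * r%:R ^- k)).
  rewrite mul1r lef_pV2 ?posrE ?exprn_gt0 ?ltr0n // lerXn2r ?nnegrE ?ler0n // ler_nat.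
  by case/andP: r_range.
by rewrite ler_wpM2r ?invr_ge0 ?exprn_ge0 ?ler0n // level_coef_ge1.
Qed.

(** One factor [k^-k] bounds the correlation, the other the loss from keeping only rainbow sets;
    [4 L] comes from the share of light edges and the choice of a level. *)
Lemma surplus_of_light_edges : A ^+ 3 / 4 <= #|light_edges E A k|%:R ->
  tau * B ^- 3 * A ^+ 2 * (k%:R ^- k * (k%:R ^- k / (4 * L%:R)) - tau * max_loss) <= D.
Proof.
move=> light.
have k_gt0R : 0 < k%:R :> R by rewrite ltr0n.
have k_big' : (j0 ^ L < k)%N by apply: ltnW.
pose fl i := flat_edges E A B k j0 (L := L) i.
have [i fli] : exists i : 'I_L, A ^+ 3 / (4 * L%:R) <= #|fl i|%:R.
  pose i0 := [arg max_(i > Ordinal L_gt0) #|fl i|]%N; exists i0.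
  have L0 : 0 < L%:R :> R by rewrite ltr0n.
  have -> : A ^+ 3 / (4 * L%:R) = A ^+ 3 / 4 / L%:R by field; rewrite gt_eqF.
  rewrite ler_pdivrMr // [leRHS]mulrC; apply: (le_trans light).
  have -> : L%:R = #|[set: 'I_L]|%:R :> R by rewrite cardsT card_ord.
  apply: (card_cover_le (G := fl)) => [e el|i _].
    have [i fi] := flat_exists A_pow k_big' L_gt0 card_E el.
    exists i; first by rewrite inE.
    by rewrite /fl /flat_edges in_set el.
  by rewrite ler_nat /i0; case: arg_maxnP => // j _; apply.
have E0 : 0 < #|E|%:R :> R by rewrite E_eq exprn_gt0.
have [e0 e0E] : exists e, e \in E by apply/card_gt0P; rewrite -(ltr0n R).
have [v0 _] : exists v, v \in e0 by apply/card_gt0P; rewrite card_E.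
pose s := (j0 ^ i.+1)%N.
pose FS := tight_sets E A B k j0 i; pose apex := tight_apex E A B k j0 i v0.
have cFS S : S \in FS -> #|S| = s.
  by move=> SF; apply: (tight_card v0 (subxx FS)).
have aFS S : S \in FS -> apex S \notin S.
  by move=> SF; apply: (tight_apex_notin v0 (subxx FS)).
have [rho le_rho] := rainbow_exists (fun S => deg E (apex S |: S)) aFS cFS.
pose SS := [set S in FS | rainbow rho (apex S) S].
have SSF : SS \subset FS by apply/subsetP => S; rewrite inE => /andP[].
have SSr S : S \in SS -> rho (apex S) = ord0 /\ {in apex S |: S &, injective rho}.
  by rewrite inE => /andP[_ /rainbowP].
pose h := s.+1./2.
have s_odd : odd s by rewrite /s oddX j0_odd orbT.
have hs : h.*2 = s.+1 by rewrite /h halfK /= s_odd subn0.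
have s_gt0 : (0 < s)%N by rewrite /s expn_gt0 ltnW.
have s_le : (s <= j0 ^ L)%N by rewrite /s leq_exp2l.
have sk : (s.+1 < k)%N by apply: leq_ltn_trans k_big; rewrite ltnS.
(* Each of the [l] colour pairs serves two of the [s + 1] roles, except that the last
   one also serves all the roles left over when [r < s + 1]. *)
pose l := minn h r./2.
have l_gt0 : (0 < l)%N.
  by rewrite /l leq_min -double_gt0 hs /= half_gt0.
have l_h : (l <= h)%N by rewrite geq_minl.
have l2r : (l.*2 <= r)%N.
  rewrite (@leq_trans (r./2).*2) ?leq_double ?geq_minr //.
  by rewrite -{2}[r]odd_double_half leq_addl.
(* If [l = r./2], then [r - 2l <= 1], and one vertex of the edge outside [apex S |: S] is enough;
   the successor in [k_big] provides it. *)
have rl : (r <= k - h.*2 + l.*2)%N.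
  rewrite /l /minn; case: ltnP => _; first by rewrite subnK ?hs ?(ltnW sk) //;
      case/andP: r_range.
  have := odd_double_half r; rewrite hs; move: sk; case: (odd r); clear; lia.
pose ty v := minn (rho v)./2 l.-1.
have ty_lt v : ((ty v).*2.+1 < r)%N.
  apply: leq_trans l2r; have : (ty v < l)%N by rewrite /ty gtn_min prednK // leqnn orbT.
  by clear; lia.
pose chi v (c : 'I_r) := chi_type R (ty v) c.
pose kap := level_coef R r (k - h.*2) h l / r%:R ^+ k.
have kap_big : k%:R ^- k <= `|kap| by apply: kap_ge; rewrite ?l_gt0 ?l2r.
have kap0 : kap != 0.
  by rewrite -normr_gt0 (lt_le_trans _ kap_big) // invr_gt0 exprn_gt0.
have coef S e : S \in SS -> e \in E -> apex S |: S \subset e ->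
    avg (fun f => hit R e f * mon chi (apex S |: S) f) = kap.
  move=> SSS eE Pe; have [a0 inj] := SSr S SSS.
  have SF := subsetP SSF S SSS.
  have cP : #|apex S |: S| = h.*2 by rewrite cardsU1 aFS // cFS // hs.
  rewrite (avg_hit_level (h := h) (l := l)) ?(card_E eE) // => y.
  pose Y (j : nat) := y (minn j./2 l.-1).
  (* [rho] maps [apex S |: S] bijectively onto the roles, so the product runs over [0..s], where
     consecutive roles share a type two by two. *)
  transitivity (\prod_(j in rho @: (apex S |: S)) Y j).
    by rewrite big_imset.
  have -> : rho @: (apex S |: S) = setT.
    by apply/eqP; rewrite eqEcard subsetT cardsT card_ord card_in_imset // cP hs ltnSn.
  rewrite (eq_bigl xpredT) => [|j]; last by rewrite inE.
  rewrite -(big_mkord xpredT Y) -hs big_mkord.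
  by rewrite (prod_double h (fun j => y (minn j l.-1))).
pose M : R := (\sum_(S in SS) #|[set e in E | apex S |: S \subset e]|)%:R.
have apex_SS S S' : S \in SS -> S' \in SS -> apex S \notin S'.
  move=> SSS SSS'; apply/negP => aS'; have [a0 _] := SSr S SSS;
      have [a0' inj] := SSr S' SSS'.
  have e : apex S = apex S' by apply: inj; rewrite ?setU11 ?a0 ?a0' // inE aS' orbT.
  by have /negP[] := aFS S' (subsetP SSF S' SSS'); rewrite -e.
have main : tau * B ^- 2 * (`|kap| / A * M)
  - tau * B ^- 2 * tau * loss_const k s L link_const * (A ^+ 2 / B) <= D.
  apply: (surplus_of_links card_r (chi := chi) (apex := apex) (j0 := j0) _ _ B_ge1
      link_const_ge1 s_gt0
    A_pow L_j0 (ltnW j0_gt1) _ apex_SS _ _ _ tau01 card_E _ _ _ kap0 coef cut_le).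
  - by move=> v i' oi; apply: chi_type_odd (ty_lt v) oi.
  - by move=> v c; apply: chi_type_le1.
  - by move=> S /(subsetP SSF)/cFS.
  - exact: (tight_link1 B_ge1 card_E v0 SSF).
  - exact: (tight_link2 B_ge1 A_pow k_gt0 card_E v0 SSF).
  - exact: (tight_link3 B_ge1 k_gt0 j0_gt1 card_E v0 SSF).
  - by rewrite E_eq.
  - exact: hit01.
  - by move=> e v; apply: hit_indep.
apply: le_trans main.
have loss_le : loss_const k s L link_const <= max_loss.
  rewrite /max_loss (bigD1 (Ordinal (ltnW sk))) //= lerDl.
  by apply: sumr_ge0 => s' _; apply: loss_const_ge0.
have L0 : 0 < L%:R :> R by rewrite ltr0n.
have kk0 : 0 < k%:R ^+ k :> R by rewrite exprn_gt0.
have M_ge : k%:R ^- k * (A ^+ 3 / (4 * L%:R * B)) <= M.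
  rewrite ler_pdivrMl // -(ler_pM2l B_gt0).
  have -> : B * (A ^+ 3 / (4 * L%:R * B)) = A ^+ 3 / (4 * L%:R) by field;
      rewrite !gt_eqF.
  apply: (le_trans fli); apply: (le_trans (sum_tight_ge _ _ _ B_ge1 j0_gt1 i v0)).
  rewrite ler_wpM2l ?(ltW B_gt0) // -natrX -natrM ler_nat.
  apply: (leq_trans le_rho); apply: leq_mul.
    by rewrite (@leq_trans (k ^ s.+1)) ?leq_exp2r ?leq_exp2l ?(leq_trans _ sk) // ltnW.
  apply: eq_leq; apply: eq_bigl => S.
  by rewrite [RHS]in_set.
have -> : tau * B ^- 3 * A ^+ 2 * (k%:R ^- k * (k%:R ^- k / (4 * L%:R)) - tau *
    max_loss) =
   tau * B ^- 2 * (k%:R ^- k / A * (k%:R ^- k * (A ^+ 3 / (4 * L%:R * B))))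
   - tau * B ^- 2 * tau * max_loss * (A ^+ 2 / B).
  by field; rewrite !gt_eqF.
have tB : 0 <= tau * B ^- 2 by rewrite mulr_ge0 // invr_ge0 exprn_ge0 // ltW.
apply: lerB.
  rewrite ler_wpM2l //; apply: ler_pM => //.
  - by rewrite divr_ge0 ?invr_ge0 ?(ltW kk0) ?(ltW A_gt0).
  - by rewrite mulr_ge0 ?invr_ge0 ?(ltW kk0) // mulr_ge0 ?invr_ge0 ?mulr_ge0 ?exprn_ge0
      ?(ltW A_gt0) ?(ltW B_gt0) ?ler0n.
  - by rewrite ler_wpM2r // invr_ge0 ltW.
rewrite ler_wpM2r //; last by rewrite ler_wpM2l // mulr_ge0.
by rewrite divr_ge0 ?exprn_ge0 ?(ltW A_gt0) ?(ltW B_gt0).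
Qed.

(** A pair has even size already, so all vertices can use the colours 0 and 1 and no roles are
    needed. *)
Lemma surplus_of_heavy_pairs (sigma : R) : 0 < sigma ->
  sigma ^+ 2 = \sum_(Q : {set T} | #|Q| == 2) (deg E Q)%:R ^+ 2 ->
  A ^+ 4 / 2 <= sigma ^+ 2 ->
  tau / B * A ^+ 2 * (k%:R ^- k / 2 - tau * pair_const R L) <= D *+ 2.
Proof.
move=> sigma_gt0 sigma_sqr big.
pose chi (v : T) (c : 'I_r) := chi_type R 0 c.
pose kap := level_coef R r (k - 1.*2) 1 1 / r%:R ^+ k.
have k_gt0R : 0 < k%:R :> R by rewrite ltr0n.
have kk0 : 0 < k%:R ^+ k :> R by rewrite exprn_gt0.
have kap_big : k%:R ^- k <= `|kap|.
  apply: kap_ge => //; rewrite r_gt1 /= subnK; first by case/andP: r_range.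
  by apply: leq_trans r_gt1 _; case/andP: r_range.
have main : tau / B * (`|kap| * sigma) - tau ^+ 2 / B * pair_const R L <= D *+ 2.
  apply: (surplus_of_pairs card_r (chi := chi) _ _ B_ge1 A_pow tau01 _ _ _ _ cut_le
      sigma_gt0 sigma_sqr).
  - by move=> v i oi; apply: chi_type_odd.
  - by move=> v c; apply: chi_type_le1.
  - by rewrite E_eq.
  - exact: hit01.
  - by move=> e v; apply: hit_indep.
  move=> Q e Q2 eE Qe; rewrite (avg_hit_level (ty := fun=>
      0%N) (h := 1) (l := 1)) ?(card_E eE) // => y.
  by rewrite prodr_const Q2 big_ord1 min0n.
apply: le_trans main.
have sigma_ge : A ^+ 2 / 2 <= sigma.
  rewrite -(ler_pXn2r (n := 2)) ?nnegrE ?(ltW sigma_gt0) ?divr_ge0 ?exprn_ge0 ?(ltW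
      A_gt0) //.
  apply: le_trans big; have A4 : 0 <= A ^+ 4 by rewrite exprn_ge0 // ltW.
  have -> : (A ^+ 2 / 2) ^+ 2 = A ^+ 4 / 4 by field.
  lra.
have -> : tau / B * A ^+ 2 * (k%:R ^- k / 2 - tau * pair_const R L) =
  tau / B * (k%:R ^- k * (A ^+ 2 / 2)) - tau ^+ 2 / B * (pair_const R L * A ^+ 2).
  by field; rewrite !gt_eqF.
have tB : 0 <= tau / B by rewrite divr_ge0 // ltW.
apply: lerB.
  rewrite ler_wpM2l //; apply: ler_pM => //; first by rewrite invr_ge0 ltW.
  by rewrite divr_ge0 ?exprn_ge0 ?(ltW A_gt0).
rewrite ler_wpM2l ?divr_ge0 ?exprn_ge0 ?(ltW B_gt0) //.
by rewrite ler_peMr ?exprn_ege1 // /pair_const ler0n.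
Qed.

End Assembly.

Lemma surplus_lower_bound (R : rcfType) (k L j0 : nat) :
  odd j0 -> (1 < j0)%N -> (0 < L)%N -> (L < j0.*2)%N -> ((j0 ^ L).+1 < k)%N ->
  exists2 c : R, 0 < c & forall (r : nat) (T : finType) (E : {set {set T}}) (B D : R),
    (2 <= r <= k)%N -> (forall e, e \in E -> #|e| = k) -> 1 <= B ->
    #|E|%:R = B ^+ (3 * L) ->
    (forall f : {ffun T -> 'I_r},
      \sum_(e in E) hit R e f <= \sum_(e in E) avg (@hit R r T e) + D) ->
    c * (B ^+ (2 * L) / B ^+ 3) <= D.
Proof.
move=> j0_odd j0_gt1 L_gt0 L_j0 k_big.
have k_gt0 : (0 < k)%N by apply: leq_ltn_trans k_big.
pose g : R := k%:R ^- k.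
have g0 : 0 < g by rewrite invr_gt0 exprn_gt0 // ltr0n.
have L0 : 0 < L%:R :> R by rewrite ltr0n.
pose a := g * (g / (4 * L%:R)); pose b := g / 2.
have a0 : 0 < a by rewrite mulr_gt0 // divr_gt0 // mulr_gt0.
have b0 : 0 < b by rewrite divr_gt0.
pose ml := max_loss R k L; pose pc := pair_const R L.
have ml0 : 0 <= ml by apply: sumr_ge0 => s _; exact: (loss_const_ge0 _ k_big).
have pc0 : 0 <= pc by apply: ler0n.
(* Small enough that in both alternatives the loss is at most half of the gain. *)
pose d := 1 + 2 * ml / a + 2 * pc / b; pose tau := d^-1.
have ma0 : 0 <= ml / a by rewrite divr_ge0 // ltW.
have pb0 : 0 <= pc / b by rewrite divr_ge0 // ltW.
have d1 : 1 <= d by rewrite /d -!mulrA; lra.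
have d0 : 0 < d by apply: lt_le_trans d1.
have tau0 : 0 < tau by rewrite invr_gt0.
have tau1 : tau <= 1 by rewrite invf_le1.
have tau01 : 0 <= tau <= 1 by rewrite ltW.
have tau_ml : tau * ml <= a / 2.
  rewrite ler_pdivrMl //; have -> : ml = ml / a * a by field; rewrite gt_eqF.
  rewrite [d * _](_ : _ = (d / 2) * a); last by ring.
  by rewrite ler_pM2r // /d -!mulrA; lra.
have tau_pc : tau * pc <= b / 2.
  rewrite ler_pdivrMl //; have -> : pc = pc / b * b by field; rewrite gt_eqF.
  rewrite [d * _](_ : _ = (d / 2) * b); last by ring.
  by rewrite ler_pM2r // /d -!mulrA; lra.
(* Half of the gain remains in each case; the pairs bound only [2 D], hence the 4. *)
pose c := Num.min (tau * a / 2) (tau * b / 4).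
have c0 : 0 < c by rewrite lt_min; apply/andP; split; apply: divr_gt0 => //;
    apply: mulr_gt0.
exists c => // r T E B D rk cE B1 EB cut_le.
have B0 : 0 < B by apply: lt_le_trans B1.
pose A := B ^+ L.
have A0 : 0 < A by rewrite exprn_gt0.
have EA : #|E|%:R = A ^+ 3 by rewrite EB mulnC exprM.
have -> : B ^+ (2 * L) = A ^+ 2 by rewrite mulnC exprM.
have AB0 : 0 <= A ^+ 2 / B ^+ 3 by rewrite divr_ge0 ?exprn_ge0 // ltW.
have [pairs|light] := pairs_or_light_edges A0 k_gt0 cE EA; last first.
  have := surplus_of_light_edges j0_odd j0_gt1 L_gt0 L_j0 k_big rk cE B1 erefl EA tau01
      cut_le light.
  apply: le_trans; rewrite -/g -/a -/ml.
  apply: (le_trans (y := tau * a / 2 * (A ^+ 2 / B ^+ 3))).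
    by rewrite ler_wpM2r // ge_min lexx.
  rewrite [leLHS](_ : _ = tau * B ^- 3 * A ^+ 2 * (a / 2)); last by ring.
  rewrite ler_wpM2l //; last by lra.
  have B3 : 0 <= B ^- 3 by rewrite invr_ge0 exprn_ge0 // ltW.
  have A2 : 0 <= A ^+ 2 by rewrite exprn_ge0 // ltW.
  by rewrite mulr_ge0 // mulr_ge0 // ltW.
pose q := \sum_(Q : {set T} | #|Q| == 2) (deg E Q)%:R ^+ 2 : R.
have A4 : 0 < A ^+ 4 / 2 by rewrite divr_gt0 ?exprn_gt0.
have q0 : 0 < q by apply: lt_le_trans A4 pairs.
have sq : Num.sqrt q ^+ 2 = q by rewrite sqr_sqrtr // ltW.
have s0 : 0 < Num.sqrt q by rewrite sqrtr_gt0.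
have := surplus_of_heavy_pairs k_big rk cE B1 erefl EA tau01 cut_le s0 sq.
rewrite sq => /(_ pairs); rewrite -/g -/b -/pc => le2.
apply: (le_trans (y := tau * b / 4 * (A ^+ 2 / B ^+ 3))).
  by rewrite ler_wpM2r // ge_min lexx orbT.
apply: (le_trans (y := tau * b / 4 * (A ^+ 2 / B))).
  rewrite ler_wpM2l //; first by rewrite divr_ge0 // mulr_ge0 // ltW.
  apply: ler_wpM2l; first by rewrite exprn_ge0 // ltW.
  rewrite lef_pV2 ?posrE ?exprn_gt0 //.
  by rewrite -[leLHS]expr1 ler_weXn2l.
have tA0 : 0 <= tau / B * A ^+ 2.
  apply: mulr_ge0; first by apply: divr_ge0; apply: ltW.
  by apply: exprn_ge0; apply: ltW.
have : tau / B * A ^+ 2 * (b / 2) <= tau / B * A ^+ 2 * (b - tau * pc).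
  by rewrite ler_wpM2l //; lra.
move=> /le_trans/(_ le2); rewrite [leLHS](_ : _ = tau * b / 4 * (A ^+ 2 / B) *+ 2);
    last by field; rewrite gt_eqF.
by rewrite lerMn2r.
Qed.

Lemma cut_size_fibres (R : realFieldType) (T : finType) (r : nat)
    (E : {set {set T}}) (f : {ffun T -> 'I_r}) :
  (cut_size E (fibres f))%:R = \sum_(e in E) hit R e f.
Proof.
rewrite /cut_size -sum1_card natr_sum big_mkcond [RHS]big_mkcond.
apply: eq_bigr => e _ /=; rewrite inE; case: (e \in E) => //=.
have -> : [forall B in fibres f, e :&: B != set0] = is_hit e f.
  apply/forall_inP/forallP => [all c|all _ /imsetP[c _ ->]].
    have /set0Pn[v] := all _ (imset_f (fun c => f @^-1: [set c]) (isT : c \in 'I_r)).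
    by rewrite !inE => ?; apply/existsP; exists v.
  have /existsP[v /andP[ve fv]] := all c.
  by apply/set0Pn; exists v; rewrite !inE ve.
by rewrite /hit; case: is_hit.
Qed.

Theorem theorem1p4 (R : realType) (eps : R) (heps : 0 < eps) :
  exists k0 : nat, forall k : nat, (k0 < k)%N ->
  exists c : R, 0 < c /\
  forall r : nat, (2 <= r <= k)%N ->
  forall (T : finType) (E : {set {set T}}) (m : nat),
  uniform_hypergraph k E -> #|E| = m -> (0 < m)%N ->
  exists P : {set {set T}},
    is_cut r P /\ c * m%:R `^ (2 / 3 - eps) <= surplus R k r E P.
Proof.
pose L := Num.bound eps^-1.
have L_big : eps^-1 < L%:R by apply: archi_boundP; rewrite invr_ge0 ltW.
have L0R : 0 < L%:R :> R by apply: lt_trans L_big; rewrite invr_gt0.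
have L_gt0 : (0 < L)%N by rewrite -(ltr0n R).
have L_eps : L%:R^-1 <= eps by rewrite invf_ple ?posrE // ltW.
(* Odd, so that all powers of [j0] are odd sizes, and large enough for [L < 2 j0]. *)
pose j0 := L.*2.+1.
have j0_odd : odd j0 by rewrite /j0 /= odd_double.
have j0_gt1 : (1 < j0)%N by rewrite ltnS double_gt0.
have L_j0 : (L < j0.*2)%N by rewrite /j0; clear; lia.
exists (j0 ^ L).+1 => k k_big.
have [c c0 bound] := surplus_lower_bound R j0_odd j0_gt1 L_gt0 L_j0 k_big.
exists c; split=> // r rk T E m cE cardE m0.
have mR : 1 <= m%:R :> R by rewrite ler1n.
have mR0 : 0 <= m%:R :> R by apply: ler0n.
pose x : R := (3 * L%:R)^-1; pose B : R := m%:R `^ x.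
have B1 : 1 <= B.
  by rewrite -(powRr0 m%:R) ler_powR // invr_ge0 mulr_ge0 // ltW.
have Bn n : B ^+ n = m%:R `^ (x * n%:R).
  by rewrite powRrM powR_mulrn // (le_trans ler01 B1).
have EB : #|E|%:R = B ^+ (3 * L).
  by rewrite cardE Bn natrM mulVf ?powRr1 // mulf_neq0 ?gt_eqF.
have [r_gt1 _] := andP rk.
have c_gt0 : (0 < #|'I_r|)%N by rewrite card_ord ltnW.
pose F (f : {ffun T -> 'I_r}) : R := \sum_(e in E) hit R e f.
pose f0 : {ffun T -> 'I_r} := [ffun=> Ordinal r_gt1].
pose f := [arg max_(f > f0) F f]%O.
have f_max f' : F f' <= F f by rewrite /f; case: arg_maxP => // i _; apply.
pose mean : R := \sum_(e in E) avg (@hit R r T e).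
have mean0 : 0 <= mean.
  by apply: sumr_ge0 => e _; apply: avg_ge0 => f'; case/andP: (hit01 R e f').
(* [D] is taken to be the surplus of the maximal colouring itself. *)
have main : c * (B ^+ (2 * L) / B ^+ 3) <= F f - mean.
  by apply: (bound r T E B) => // f'; rewrite addrC subrK f_max.
have B0 : 0 < B by apply: lt_le_trans B1.
(* Needed for nonempty parts: the surplus is positive, so [f] hits some edge and therefore uses
   every colour. *)
have Ff0 : F f != 0.
  have : 0 < c * (B ^+ (2 * L) / B ^+ 3) by rewrite mulr_gt0 // divr_gt0 // exprn_gt0.
  by move=> /lt_le_trans/(_ main); rewrite subr_gt0 => /(le_lt_trans mean0)/gt_eqF ->.
have onto c' : exists v, f v = c'.
  have [e eE hite] : exists2 e, e \in E & is_hit e f.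
    case: (pickP (fun e => (e \in E) && is_hit e f)) => [e /andP[? ?]|none];
        first by exists e.
    case/eqP: Ff0; rewrite /F big1 // => e eE.
    by move: (none e); rewrite eE /hit /= => ->.
  by have /existsP[v /andP[_ /eqP fv]] := forallP hite c'; exists v.
exists (fibres f); split; first exact: fibres_partition.
have meanE : mean = (stirling2 k r * r`!)%:R / r%:R ^+ k * #|E|%:R.
  rewrite /mean (eq_bigr (fun=> (stirling2 k r * r`!)%:R / r%:R ^+ k)) => [|e eE].
    by rewrite sumr_const mulr_natr.
  by apply: avg_hit => //; apply: cE.
rewrite /surplus cut_size_fibres -meanE; apply: le_trans main.
rewrite ler_wpM2l ?(ltW c0) //.
have -> : B ^+ (2 * L) / B ^+ 3 = m%:R `^ (2 / 3 - L%:R^-1).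
  rewrite !Bn powRB; last by rewrite pnatr_eq0 -lt0n m0 implybT.
  by rewrite /x natrM; congr (_ `^ _ / _ `^ _); field; rewrite gt_eqF.
by rewrite ler_powR // lerB.
Qed.
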